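(* Suppose the parameters $(A_0,\ldots,A_{k-1},q_0,\ldots,q_{k-1},q,\lambda)$ of $R$ are admissible. Then the $R$-module homomorphism $\phi:\Xi\to\mathscr{B}_2^k(R)$ defined by $$v_{i,j}\mapsto Y^ieY^j,\qquad u_{i,j}\mapsto Y^iXY^j,\qquad w_{i,j}\mapsto XY^iXY^j\qquad(0\le i,j\le k-1)$$ is an isomorphism of (left) $\mathscr{B}_2^k(R)$-modules. Furthermore $\mathscr{B}_2^k(R)$ is a free $R$-module of rank $3k^2$ with basis $$\{Y^ieY^j,\;Y^iXY^j,\;XY^iXY^j\mid i,j=0,\ldots,k-1\}.$$
   Context: Parameters. Let $k\ge 1$ be a natural number. Let $R$ be a commutative ring containing units $q_0,q,\lambda$ and further elements $A_0,\ldots,A_{k-1},q_1,\ldots,q_{k-1}$ such that $\lambda-\lambda^{-1}=\delta(1-A_0)$, where $\delta:=q-q^{-1}$. Assume $\delta$ is not a zero divisor in $R$. Put $q_k:=-1$. The algebra. $\mathscr{B}_2^k(R)$ is the unital associative $R$-algebra generated by $Y^{\pm1},X^{\pm1},e$ subject to: $Y^k=\sum_{i=0}^{k-1}q_iY^i$; $X-X^{-1}=\delta(1-e)$; $XYXY=YXYX$; $Xe=\lambda e=eX$; $YXYe=\lambda^{-1}e=eYXY$; $eY^me=A_me$ for $0\le m\le k-1$. It is regarded as a left module over itself by left multiplication. Admissibility. Write $k=2z-\epsilon$ with $z=\lceil k/2\rceil$, so $\epsilon=0$ if $k$ is even and $\epsilon=1$ if $k$ is odd. Set $$\beta=q_0\lambda-q_0^{-1}\lambda^{-1}+(1-\epsilon)\delta,$$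 and for $1\le l\le k-1$, $$h_l=\lambda^{-1}(q_l+q_0^{-1}q_{k-l})+\delta\left[\sum_{r=1}^{k-l}q_{r+l}A_r-\sum_{i=\max(l+1,z)}^{\lfloor (l+k)/2\rfloor}q_{2i-l}+\sum_{i=\lceil l/2\rceil}^{\min(l,z-1)}q_{2i-l}\right]$$ (empty sums are $0$). The parameters are called admissible if $\lambda-\lambda^{-1}=\delta(1-A_0)$ and $h_1=\cdots=h_{k-1}=\beta=0$. The module $V$. $V$ is the free $R$-module with basis $v_0,\ldots,v_{k-1}$. The linear map $Y_V:V\to V$ is given by $Y_Vv_i=v_{i+1}$ for $0\le i\le k-2$ and $Y_Vv_{k-1}=\sum_{i=0}^{k-1}q_iv_i$; it is invertible since $q_0$ is a unit. Put $v_s=Y_V^sv_0$ for every integer $s$. The linear maps $X_V,E_V:V\to V$ are given on the basis by $X_Vv_0=\lambda v_0$, $X_Vv_1=\lambda^{-1}Y_V^{-1}v_0$ (if $k\ge 2$), $X_Vv_i=Y_V^{-1}X_Vv_{i-1}-\delta v_{i-2}+\delta A_{i-1}Y_V^{-1}v_0$ for $2\le i\le k-1$, and $E_Vv_i=A_iv_0$ for $0\le i\le k-1$. The module $\Xi$. Let $\Xi_0=V\otimes_RV$, let $\xi_1:\Xi_0\to\Xi_1$ and $\xi_2:\Xi_0\to\Xi_2$ be isomorphisms onto two further copies of $\Xi_0$, and $\Xi=\Xi_0\oplus\Xi_1\oplus\Xi_2$. For all integers $i,j$ put $v_{i,j}=v_i\otimes v_j$, $u_{i,j}=\xi_1(v_{i,j})$,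 $w_{i,j}=\xi_2(v_{i,j})$; the elements $v_{i,j},u_{i,j},w_{i,j}$ with $0\le i,j\le k-1$ form an $R$-basis of $\Xi$. Define $R$-linear maps $\bar Y,\bar X,\bar E:\Xi\to\Xi$ as follows. On $\Xi_0$ they are $Y_V\otimes 1$, $X_V\otimes 1$, $E_V\otimes 1$ respectively. For $0\le i,j\le k-1$: $$\bar Eu_{i,j}=v_0\otimes Y_V^jX_VY_V^iv_0,\qquad \bar Ew_{i,j}=v_0\otimes Y_V^jX_VY_V^iX_Vv_0=\lambda\bar Eu_{i,j},$$ $$\bar Xu_{i,j}=w_{i,j},\qquad \bar Xw_{i,j}=u_{i,j}+\delta w_{i,j}-\delta\lambda\bar Eu_{i,j},$$ $$\bar Yu_{i,j}=u_{i+1,j},\qquad \bar Yw_{i,j}=\bar Wu_{i,j+1}+\delta u_{1,i+j}-\delta\,\bar Y\bar Xv_{i,j},$$ where $\bar W:=\bar X-\delta+\delta\bar E$. When the parameters are admissible, $\Xi$ is a left $\mathscr{B}_2^k(R)$-module with $Y,X,X^{-1},e$ acting by $\bar Y,\bar X,\bar W,\bar E$ respectively; this is the module structure on $\Xi$ in the claim. *)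

(* Defs.v *)
From HB Require Import structures.
From mathcomp Require Import all_boot all_algebra.
From mathcomp Require Import boolp.

Set Implicit Arguments.
Unset Strict Implicit.
Unset Printing Implicit Defensive.

Import GRing.Theory.

Local Open Scope ring_scope.
Local Open Scope quotient_scope.

(* Only the values [A 0 .. A k.-1] and [qs 0 .. qs k.-1] of the families
   [A, qs : nat -> R] are ever used. *)

Definition delta (R : comUnitRingType) (q : R) : R := q - q^-1.

Section Admissible.
Context {R : comUnitRingType}.
Implicit Types (k : nat) (q lam : R) (A qs : nat -> R).

(* The convention q_k := -1. *)
Definition qext k qs (i : nat) : R := if i == k then -1 else qs i.

(* k = 2 z - epsilon *)
Definition adm_z k : nat := uphalf k.
Definition adm_epsilon k : nat := odd k.

Definition adm_beta k q lam qs : R :=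
  qs 0%N * lam - (qs 0%N)^-1 * lam^-1 + (1 - (adm_epsilon k)%:R) * delta q.

Definition adm_h k q lam A qs (l : nat) : R :=
  let qq := qext k qs in
  lam^-1 * (qq l + (qs 0%N)^-1 * qq (k - l)%N)
  + delta q * (\sum_(1 <= r < (k - l).+1) qq (r + l)%N * A r
               - \sum_(maxn l.+1 (adm_z k) <= i < ((l + k)./2).+1)
                   qq (2 * i - l)%N
               + \sum_(uphalf l <= i < (minn l (adm_z k).-1).+1)
                   qq (2 * i - l)%N).

Definition admissible k q lam A qs : Prop :=
  [/\ lam - lam^-1 = delta q * (1 - A 0%N),
      forall l : nat, (1 <= l <= k.-1)%N -> adm_h k q lam A qs l = 0
    & adm_beta k q lam qs = 0].

End Admissible.

(* The algebra is the quotient of the set of algebra expressions in the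
   generators by the least congruence containing the axioms of unital
   associative R-algebras and the defining relations. *)

Inductive bterm (R : Type) : Type :=
  | TY | TYinv | TX | TXinv | Te
  | TScal of R
  | TAdd of bterm R & bterm R
  | TMul of bterm R & bterm R.

Arguments TY {R}.
Arguments TYinv {R}.
Arguments TX {R}.
Arguments TXinv {R}.
Arguments Te {R}.

HB.instance Definition _ (R : Type) := gen_eqMixin (bterm R).
HB.instance Definition _ (R : Type) := gen_choiceMixin (bterm R).

Section Presentation.
Variables (R : comUnitRingType) (k : nat) (q lam : R) (A qs : nat -> R).

Local Notation tm := (bterm R).
Local Notation "a ** b" := (TMul a b) (at level 40, left associativity).
Local Notation "a ++' b" := (TAdd a b) (at level 50, left associativity).
Local Notation "c %:K" := (TScal c) (at level 1, format "c %:K").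

Definition texp (t : tm) (n : nat) : tm := iter n (TMul t) 1%:K.
Definition topp (t : tm) : tm := (-1)%:K ** t.

Inductive brel : tm -> tm -> Prop :=
  (* congruence *)
  | brel_refl a : brel a a
  | brel_sym a b : brel a b -> brel b a
  | brel_trans b a c : brel a b -> brel b c -> brel a c
  | brel_add a a' b b' : brel a a' -> brel b b' -> brel (a ++' b) (a' ++' b')
  | brel_mul a a' b b' : brel a a' -> brel b b' -> brel (a ** b) (a' ** b')
  (* unital associative R-algebras *)
  | brel_addA a b c : brel (a ++' (b ++' c)) ((a ++' b) ++' c)
  | brel_addC a b : brel (a ++' b) (b ++' a)
  | brel_add0 a : brel (0%:K ++' a) a
  | brel_addN a : brel (topp a ++' a) 0%:K
  | brel_mulA a b c : brel (a ** (b ** c)) ((a ** b) ** c)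
  | brel_mul1 a : brel (1%:K ** a) a
  | brel_mulDl a b c : brel ((a ++' b) ** c) ((a ** c) ++' (b ** c))
  | brel_mulDr a b c : brel (a ** (b ++' c)) ((a ** b) ++' (a ** c))
  | brel_scalD c d : brel (c + d)%:K (c%:K ++' d%:K)
  | brel_scalM c d : brel (c * d)%:K (c%:K ** d%:K)
  | brel_scalC c a : brel (c%:K ** a) (a ** c%:K)
  (* defining relations *)
  | brel_YV : brel (TY ** TYinv) 1%:K
  | brel_VY : brel (TYinv ** TY) 1%:K
  | brel_XV : brel (TX ** TXinv) 1%:K
  | brel_VX : brel (TXinv ** TX) 1%:K
  | brel_Yk : brel (texp TY k) (\big[@TAdd R/0%:K]_(i < k) ((qs i)%:K ** texp TY i))
  | brel_skein : brel (TX ++' topp TXinv) ((delta q)%:K ** (1%:K ++' topp Te))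
  | brel_braid : brel (TX ** TY ** TX ** TY) (TY ** TX ** TY ** TX)
  | brel_Xe : brel (TX ** Te) (lam%:K ** Te)
  | brel_eX : brel (Te ** TX) (lam%:K ** Te)
  | brel_YXYe : brel (TY ** TX ** TY ** Te) ((lam^-1)%:K ** Te)
  | brel_eYXY : brel (Te ** TY ** TX ** TY) ((lam^-1)%:K ** Te)
  | brel_eYe (m : nat) : (m < k)%N -> brel (Te ** texp TY m ** Te) ((A m)%:K ** Te).

Definition brelb : rel tm := fun a b => `[< brel a b >].

Lemma brelb_refl : reflexive brelb.
Proof. by move=> a; apply/asboolP/brel_refl. Qed.

Lemma brelb_sym : symmetric brelb.
Proof. by move=> a b; apply/asboolP/asboolP; apply: brel_sym. Qed.

Lemma brelb_trans : transitive brelb.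
Proof.
by move=> b a c /asboolP ab /asboolP bc; apply/asboolP; apply: brel_trans ab bc.
Qed.

Canonical brelb_equiv := EquivRel brelb brelb_refl brelb_sym brelb_trans.

Definition bmw : Type := {eq_quot brelb_equiv}.

HB.instance Definition _ := Choice.on bmw.
HB.instance Definition _ := EqQuotient.on bmw.

Local Notation cl := (\pi_bmw : tm -> bmw).

Lemma bmw_eqP (a b : tm) : cl a = cl b <-> brel a b.
Proof.
split=> [/eqmodP/asboolP //|ab].
by apply/eqmodP/asboolP.
Qed.

Lemma bmw_repr (a : tm) : brel (repr (cl a)) a.
Proof. by apply/bmw_eqP; rewrite reprK. Qed.

Definition bmw_add (x y : bmw) : bmw := cl (repr x ++' repr y).
Definition bmw_mul (x y : bmw) : bmw := cl (repr x ** repr y).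
Definition bmw_opp (x : bmw) : bmw := cl (topp (repr x)).
Definition bmw_scale (c : R) (x : bmw) : bmw := cl (c%:K ** repr x).

Lemma bmw_addE a b : bmw_add (cl a) (cl b) = cl (a ++' b).
Proof. by apply/bmw_eqP/brel_add; apply: bmw_repr. Qed.

Lemma bmw_mulE a b : bmw_mul (cl a) (cl b) = cl (a ** b).
Proof. by apply/bmw_eqP/brel_mul; apply: bmw_repr. Qed.

Lemma bmw_scaleE c a : bmw_scale c (cl a) = cl (c%:K ** a).
Proof. by apply/bmw_eqP/brel_mul; [apply: brel_refl | apply: bmw_repr]. Qed.

Lemma bmw_oppE a : bmw_opp (cl a) = cl (topp a).
Proof. exact: bmw_scaleE. Qed.

Lemma bmw_ind (P : bmw -> Prop) : (forall a, P (cl a)) -> forall x, P x.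
Proof. by move=> Pcl x; rewrite -[x]reprK. Qed.

Fact bmw_addA : associative bmw_add.
Proof.
elim/bmw_ind=> a; elim/bmw_ind=> b; elim/bmw_ind=> c.
by rewrite !bmw_addE; apply/bmw_eqP/brel_addA.
Qed.

Fact bmw_addC : commutative bmw_add.
Proof.
elim/bmw_ind=> a; elim/bmw_ind=> b.
by rewrite !bmw_addE; apply/bmw_eqP/brel_addC.
Qed.

Fact bmw_add0 : left_id (cl 0%:K) bmw_add.
Proof. by elim/bmw_ind=> a; rewrite bmw_addE; apply/bmw_eqP/brel_add0. Qed.

Fact bmw_addN : left_inverse (cl 0%:K) bmw_opp bmw_add.
Proof.
by elim/bmw_ind=> a; rewrite bmw_oppE bmw_addE; apply/bmw_eqP/brel_addN.
Qed.

HB.instance Definition _ :=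
  GRing.isZmodule.Build bmw bmw_addA bmw_addC bmw_add0 bmw_addN.

Fact bmw_mulA : associative bmw_mul.
Proof.
elim/bmw_ind=> a; elim/bmw_ind=> b; elim/bmw_ind=> c.
by rewrite !bmw_mulE; apply/bmw_eqP/brel_mulA.
Qed.

Fact bmw_mul1 : left_id (cl 1%:K) bmw_mul.
Proof. by elim/bmw_ind=> a; rewrite bmw_mulE; apply/bmw_eqP/brel_mul1. Qed.

Fact bmw_mulr1 : right_id (cl 1%:K) bmw_mul.
Proof.
elim/bmw_ind=> a; rewrite bmw_mulE; apply/bmw_eqP.
exact: brel_trans (brel_sym (brel_scalC _ _)) (brel_mul1 _).
Qed.

Fact bmw_mulDl : left_distributive bmw_mul +%R.
Proof.
elim/bmw_ind=> a; elim/bmw_ind=> b; elim/bmw_ind=> c.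
by rewrite /GRing.add /= !(bmw_addE, bmw_mulE); apply/bmw_eqP/brel_mulDl.
Qed.

Fact bmw_mulDr : right_distributive bmw_mul +%R.
Proof.
elim/bmw_ind=> a; elim/bmw_ind=> b; elim/bmw_ind=> c.
by rewrite /GRing.add /= !(bmw_addE, bmw_mulE); apply/bmw_eqP/brel_mulDr.
Qed.

(* Only a [pzRingType]: that 1 != 0 in this algebra is not known a priori. *)
HB.instance Definition _ :=
  GRing.Zmodule_isPzRing.Build bmw bmw_mulA bmw_mul1 bmw_mulr1 bmw_mulDl bmw_mulDr.

Fact bmw_scaleA a b (x : bmw) :
  bmw_scale a (bmw_scale b x) = bmw_scale (a * b) x.
Proof.
elim/bmw_ind: x => x; rewrite !bmw_scaleE; apply/bmw_eqP.
apply: (brel_trans (brel_mulA _ _ _)); apply: brel_mul (brel_refl _).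
exact/brel_sym/brel_scalM.
Qed.

Fact bmw_scale1 : left_id 1 bmw_scale.
Proof. by elim/bmw_ind=> a; rewrite bmw_scaleE; apply/bmw_eqP/brel_mul1. Qed.

Fact bmw_scaleDr : right_distributive bmw_scale +%R.
Proof.
move=> c; elim/bmw_ind=> a; elim/bmw_ind=> b.
by rewrite /GRing.add /= !(bmw_addE, bmw_scaleE); apply/bmw_eqP/brel_mulDr.
Qed.

Fact bmw_scaleDl (x : bmw) : {morph bmw_scale^~ x : a b / a + b}.
Proof.
move=> a b; elim/bmw_ind: x => x.
rewrite [in RHS]/GRing.add /= !(bmw_addE, bmw_scaleE); apply/bmw_eqP.
apply: brel_trans (brel_mulDl _ _ _).
exact: brel_mul (brel_scalD _ _) (brel_refl _).
Qed.

HB.instance Definition _ :=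
  GRing.Zmodule_isLmodule.Build R bmw
    bmw_scaleA bmw_scale1 bmw_scaleDr bmw_scaleDl.

Definition bY : bmw := cl TY.
Definition bYinv : bmw := cl TYinv.
Definition bX : bmw := cl TX.
Definition bXinv : bmw := cl TXinv.
Definition be : bmw := cl Te.

Lemma clD a b : cl (a ++' b) = cl a + cl b.
Proof. by rewrite /GRing.add /= bmw_addE. Qed.

Lemma clM a b : cl (a ** b) = cl a * cl b.
Proof. by rewrite /GRing.mul /= bmw_mulE. Qed.

Lemma cl0 : cl 0%:K = 0. Proof. by []. Qed.
Lemma cl1 : cl 1%:K = 1. Proof. by []. Qed.

Lemma clZ c a : cl (c%:K ** a) = c *: cl a.
Proof. by rewrite /GRing.scale /= bmw_scaleE. Qed.

Lemma clN a : cl (topp a) = - cl a.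
Proof. by rewrite clZ scaleN1r. Qed.

Lemma clscal c : cl c%:K = c *: (1 : bmw).
Proof.
rewrite -cl1 -clZ; apply/bmw_eqP.
exact: brel_trans (brel_sym (brel_mul1 _)) (brel_sym (brel_scalC _ _)).
Qed.

Lemma clX a n : cl (texp a n) = cl a ^+ n.
Proof. by elim: n => [|n IHn]; rewrite ?expr0 // exprS -IHn -clM. Qed.

Lemma cl_sum n (F : 'I_n -> tm) :
  cl (\big[@TAdd R/0%:K]_(i < n) F i) = \sum_(i < n) cl (F i).
Proof.
by apply: (big_morph (fun a : tm => cl a)) => [a b|]; [apply: clD | apply: cl0].
Qed.

Lemma bmw_scalerAl c (x y : bmw) : c *: (x * y) = (c *: x) * y.
Proof.
elim/bmw_ind: x => x; elim/bmw_ind: y => y.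
by rewrite -clM -!clZ -clM; apply/bmw_eqP/brel_mulA.
Qed.

Lemma bmw_scalerAr c (x y : bmw) : c *: (x * y) = x * (c *: y).
Proof.
have scC (z : bmw) : c *: z = z * (c *: (1 : bmw)).
  elim/bmw_ind: z => z.
  by rewrite -clscal -clM -clZ; apply/bmw_eqP/brel_scalC.
by rewrite scC -mulrA -scC.
Qed.

(* The five generators of an R-algebra [B] (a ring with a central ring
   morphism [f] from R) satisfying the defining relations. *)
Record bmw_relations (B : pzRingType) (f : R -> B) (y yV x xV e : B) : Prop := {
  rel_YV : y * yV = 1 /\ yV * y = 1;
  rel_XV : x * xV = 1 /\ xV * x = 1;
  rel_Yk : y ^+ k = \sum_(i < k) f (qs i) * y ^+ i;
  rel_skein : x - xV = f (delta q) * (1 - e);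
  rel_braid : x * y * x * y = y * x * y * x;
  rel_Xe : x * e = f lam * e /\ e * x = f lam * e;
  rel_YXYe : y * x * y * e = f lam^-1 * e /\ e * y * x * y = f lam^-1 * e;
  rel_eYe (m : nat) : (m < k)%N -> e * y ^+ m * e = f (A m) * e }.

Lemma bmw_satisfies : bmw_relations (fun c => c *: (1 : bmw)) bY bYinv bX bXinv be.
Proof.
have scl c (x : bmw) : (c *: (1 : bmw)) * x = c *: x by rewrite -bmw_scalerAl mul1r.
rewrite /bY /bYinv /bX /bXinv /be; split.
- by split; [have /bmw_eqP := brel_YV | have /bmw_eqP := brel_VY]; rewrite clM cl1.
- by split; [have /bmw_eqP := brel_XV | have /bmw_eqP := brel_VX]; rewrite clM cl1.
- have /bmw_eqP := brel_Yk; rewrite clX cl_sum => ->.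
  by apply: eq_bigr => i _; rewrite scl clZ clX.
- by have /bmw_eqP := brel_skein; rewrite scl clZ !clD !clN cl1.
- by have /bmw_eqP := brel_braid; rewrite !clM.
- by split; [have /bmw_eqP := brel_Xe | have /bmw_eqP := brel_eX];
    rewrite clZ !clM ?scl.
- by split; [have /bmw_eqP := brel_YXYe | have /bmw_eqP := brel_eYXY];
    rewrite clZ !clM ?scl.
- by move=> m /brel_eYe /bmw_eqP; rewrite clZ !clM clX scl.
Qed.

Section Universal.
Variables (B : pzRingType) (f : {rmorphism R -> B}) (y yV x xV e : B).
Hypothesis fC : forall c b, f c * b = b * f c.
Hypothesis relB : bmw_relations f y yV x xV e.

Fixpoint beval (t : tm) : B :=
  match t with
  | TY => y | TYinv => yV | TX => x | TXinv => xV | Te => e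
  | TScal c => f c
  | TAdd a b => beval a + beval b
  | TMul a b => beval a * beval b
  end.

Lemma beval_exp a n : beval (texp a n) = beval a ^+ n.
Proof. by elim: n => [|n IHn] /=; rewrite ?rmorph1 // exprS -IHn. Qed.

Lemma beval_rel a b : brel a b -> beval a = beval b.
Proof.
case: relB => -[r1 r2] [r3 r4] r5 r6 r7 [r8 r9] [r10 r11] r12.
elim=> //= {a b}; rewrite ?rmorph1 ?rmorph0 ?rmorphN1 ?mulN1r //.
- by move=> b a c _ -> _ ->.
- by move=> a a' b b' _ -> _ ->.
- by move=> a a' b b' _ -> _ ->.
- by move=> a b c; rewrite addrA.
- by move=> a b; rewrite addrC.
- by move=> a; rewrite add0r.
- by move=> a; rewrite mulN1r addNr.
- by move=> a b c; rewrite mulrA.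
- by move=> a; rewrite mul1r.
- by move=> a b c; rewrite mulrDl.
- by move=> a b c; rewrite mulrDr.
- by move=> c d; rewrite rmorphD.
- by move=> c d; rewrite rmorphM.
- rewrite beval_exp /= r5 (big_morph beval (id1 := 0) (op1 := +%R)) //= ?rmorph0 //.
  by apply: eq_bigr => i _ /=; rewrite beval_exp.
- by move=> m /r12; rewrite beval_exp.
Qed.

Definition bmw_lift (b : bmw) : B := beval (repr b).

Lemma bmw_lift_cl a : bmw_lift (cl a) = beval a.
Proof. exact/beval_rel/bmw_repr. Qed.

(* The universal property of the algebra given by generators and relations. *)
Lemma bmw_universal :
  let is_lift (g : bmw -> B) :=
    [/\ zmod_morphism g, monoid_morphism g, forall c b, g (c *: b) = f c * g b
      & [/\ g bY = y, g bYinv = yV, g bX = x, g bXinv = xV & g be = e]] in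
  is_lift bmw_lift /\ forall g, is_lift g -> g =1 bmw_lift.
Proof.
move=> is_lift; split.
  split; last by split; apply: bmw_lift_cl.
  - elim/bmw_ind=> a; elim/bmw_ind=> b.
    by rewrite -clN -clD !bmw_lift_cl /= rmorphN1 mulN1r.
  - split; first by rewrite -cl1 bmw_lift_cl /= rmorph1.
    by elim/bmw_ind=> a; elim/bmw_ind=> b; rewrite -clM !bmw_lift_cl.
  - by move=> c; elim/bmw_ind=> a; rewrite -clZ !bmw_lift_cl.
move=> g [gB [g1 gM] gZ [gY gYV gX gXV ge]].
have g0 : g 0 = 0 by rewrite -(subrr 0) gB subrr.
have gN b : g (- b) = - g b by rewrite -sub0r gB g0 sub0r.
have gD b c : g (b + c) = g b + g c by rewrite -{1}[c]opprK gB gN opprK.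
elim/bmw_ind=> a; rewrite bmw_lift_cl.
elim: a => //= [c|a IHa b IHb|a IHa b IHb].
- by rewrite clscal gZ g1 mulr1.
- by rewrite clD gD IHa IHb.
- by rewrite clM gM IHa IHb.
Qed.

End Universal.

(* The module V, as column vectors, with linear maps as matrices. *)

Definition V_basis (i : nat) : 'cV[R]_k := \col_(a < k) (a == i :> nat)%:R.

(* The matrix of the linear map sending the [j]-th basis vector to [f j]. *)
Definition V_lin (f : nat -> 'cV[R]_k) : 'M[R]_k := \matrix_(a, j) f j a 0.

Definition YV : 'M[R]_k :=
  V_lin (fun i => if (i.+1 < k)%N then V_basis i.+1
                  else \sum_(j < k) qs j *: V_basis j).

Definition vv (s : nat) : 'cV[R]_k := YV ^+ s *m V_basis 0.

Fixpoint XVv (i : nat) : 'cV[R]_k :=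
  match i with
  | 0 => lam *: vv 0
  | S i' =>
    match i' with
    | 0 => lam^-1 *: (invmx YV *m vv 0)
    | S j => invmx YV *m XVv i' - delta q *: vv j
             + (delta q * A i') *: (invmx YV *m vv 0)
    end
  end.

Definition XV : 'M[R]_k := V_lin XVv.
Definition EV : 'M[R]_k := V_lin (fun i => A i *: vv 0).

(* The module Xi: V (x) V is 'M_k, with a (x) b = a *m b^T, so that f (x) 1 is
   left multiplication by the matrix of f. *)

Definition tens (a b : 'cV[R]_k) : 'M[R]_k := a *m b^T.

Definition Xi : Type := ('M[R]_k * 'M[R]_k * 'M[R]_k)%type.

HB.instance Definition _ := GRing.Lmodule.on Xi.

Definition iota0 (t : 'M[R]_k) : Xi := (t, 0, 0).
Definition xi1 (t : 'M[R]_k) : Xi := (0, t, 0).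
Definition xi2 (t : 'M[R]_k) : Xi := (0, 0, t).

Definition v_ (i j : nat) : Xi := iota0 (tens (vv i) (vv j)).
Definition u_ (i j : nat) : Xi := xi1 (tens (vv i) (vv j)).
Definition w_ (i j : nat) : Xi := xi2 (tens (vv i) (vv j)).

(* The linear map from V (x) V sending the basis vectors
   v_i (x) v_j (0 <= i, j < k) to [f i j]. *)
Definition lin2 (M : lmodType R) (f : nat -> nat -> M) (t : 'M[R]_k) : M :=
  \sum_(i < k) \sum_(j < k) t i j *: f i j.

(* The linear map from Xi with prescribed values on v_{i,j}, u_{i,j}, w_{i,j}
   (0 <= i, j < k). *)
Definition Xi_lin (M : lmodType R) (fv fu fw : nat -> nat -> M) (x : Xi) : M :=
  lin2 fv x.1.1 + lin2 fu x.1.2 + lin2 fw x.2.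

Definition Ebar_u (i j : nat) : Xi :=
  iota0 (tens (vv 0) (YV ^+ j *m XV *m YV ^+ i *m vv 0)).

Definition Ebar : Xi -> Xi :=
  Xi_lin (fun i j => iota0 (tens (EV *m vv i) (vv j)))
         Ebar_u
         (fun i j => iota0 (tens (vv 0) (YV ^+ j *m XV *m YV ^+ i *m XV *m vv 0))).

Definition Xbar : Xi -> Xi :=
  Xi_lin (fun i j => iota0 (tens (XV *m vv i) (vv j)))
         (fun i j => w_ i j)
         (fun i j => u_ i j + delta q *: w_ i j - (delta q * lam) *: Ebar_u i j).

Definition Wbar (x : Xi) : Xi := Xbar x - delta q *: x + delta q *: Ebar x.

(* The last summand of the third argument is - delta Ybar (Xbar v_{i,j}). *)
Definition Ybar : Xi -> Xi :=
  Xi_lin (fun i j => iota0 (tens (YV *m vv i) (vv j)))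
         (fun i j => u_ i.+1 j)
         (fun i j => Wbar (u_ i j.+1) + delta q *: u_ 1 (i + j)
                     - delta q *: iota0 (tens (YV *m (XV *m vv i)) (vv j))).

Definition phi : Xi -> bmw :=
  Xi_lin (fun i j => bY ^+ i * be * bY ^+ j)
         (fun i j => bY ^+ i * bX * bY ^+ j)
         (fun i j => bX * bY ^+ i * bX * bY ^+ j).

(* Left module structures on Xi over the R-algebra [bmw], extending the
   R-module structure. *)
Record Xi_module_structure (act : bmw -> Xi -> Xi) : Prop := {
  act1 : forall x, act 1 x = x;
  actM : forall b c x, act (b * c) x = act b (act c x);
  actDl : forall b c x, act (b + c) x = act b x + act c x;
  actDr : forall b x y, act b (x + y) = act b x + act b y;
  act_scal : forall c x, act (c *: (1 : bmw)) x = c *: x }.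

(* The structure is determined by the action of the generators. *)
Record Xi_action (act : bmw -> Xi -> Xi) : Prop := {
  act_module : Xi_module_structure act;
  act_Y : act bY =1 Ybar;
  act_X : act bX =1 Xbar;
  act_Xinv : act bXinv =1 Wbar;
  act_e : act be =1 Ebar }.

(* [f] is an isomorphism of left modules from Xi, with the action [act], to the
   left regular module. *)
Record is_module_iso (act : bmw -> Xi -> Xi) (f : Xi -> bmw) : Prop := {
  iso_linear : linear f;
  iso_act : forall b x, f (act b x) = b * f x;
  iso_bij : bijective f }.

Definition bmw_basis_family (s : 'I_k * 'I_k + 'I_k * 'I_k + 'I_k * 'I_k) : bmw :=
  match s with
  | inl (inl (i, j)) => bY ^+ i * be * bY ^+ j
  | inl (inr (i, j)) => bY ^+ i * bX * bY ^+ j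
  | inr (i, j) => bX * bY ^+ i * bX * bY ^+ j
  end.

Lemma vv_basis i : (i < k)%N -> vv i = V_basis i.
Proof.
elim: i => [|i IHi] ltik; first by rewrite /vv expr0 mul1mx.
rewrite /vv exprS -[_ * _]/(_ *m _) -mulmxA -/(vv i) IHi ?(ltnW ltik) //.
apply/colP => a; rewrite !mxE (bigD1 (Ordinal (ltnW ltik))) //= !mxE ltik mxE.
rewrite eqxx mulr1 big1 ?addr0 // => j nej; rewrite !mxE -val_eqE /= in nej *.
by rewrite (negbTE nej) mulr0.
Qed.

Lemma tens_basis (i j : 'I_k) : tens (vv i) (vv j) = delta_mx i j.
Proof.
rewrite !vv_basis //; apply/matrixP => a b; rewrite !mxE big_ord1 !mxE !val_eqE.
by rewrite -mulnb natrM.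
Qed.

Lemma lin2_basis (M : lmodType R) (f : nat -> nat -> M) (i j : 'I_k) :
  lin2 f (tens (vv i) (vv j)) = f i j.
Proof.
rewrite tens_basis /lin2 (bigD1 i) //= [X in _ + X]big1 ?addr0; last first.
  move=> a nei; rewrite big1 // => b _.
  by rewrite mxE (negbTE nei) scale0r.
rewrite (bigD1 j) //= [X in _ + X]big1 ?addr0.
  by rewrite mxE !eqxx scale1r.
by move=> b nej; rewrite mxE (negbTE nej) andbF scale0r.
Qed.

Fact lin2_is_linear (M : lmodType R) (f : nat -> nat -> M) : linear (lin2 f).
Proof.
move=> c s t; rewrite /lin2 scaler_sumr -big_split; apply: eq_bigr => i _ /=.
rewrite scaler_sumr -big_split; apply: eq_bigr => j _ /=.
by rewrite !mxE scalerDl scalerA.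
Qed.

HB.instance Definition _ (M : lmodType R) (f : nat -> nat -> M) :=
  GRing.isLinear.Build R 'M[R]_k M *:%R (lin2 f) (lin2_is_linear f).

Fact Xi_lin_is_linear (M : lmodType R) (fv fu fw : nat -> nat -> M) :
  linear (Xi_lin fv fu fw).
Proof.
move=> c s t; rewrite /Xi_lin /= !linearP !scalerDr.
rewrite (addrACA (c *: lin2 fv s.1.1)) (addrACA (_ + _)); congr (_ + _).
Qed.

HB.instance Definition _ (M : lmodType R) (fv fu fw : nat -> nat -> M) :=
  GRing.isLinear.Build R Xi M *:%R (Xi_lin fv fu fw) (Xi_lin_is_linear fv fu fw).

HB.instance Definition _ := GRing.Linear.on Ebar.
HB.instance Definition _ := GRing.Linear.on Xbar.
HB.instance Definition _ := GRing.Linear.on Ybar.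
HB.instance Definition _ := GRing.Linear.on phi.

Section OnBasis.
Variables (i j : 'I_k).

Lemma Xi_lin_v (M : lmodType R) (fv fu fw : nat -> nat -> M) :
  Xi_lin fv fu fw (v_ i j) = fv i j.
Proof. by rewrite /Xi_lin /= lin2_basis !linear0 !addr0. Qed.

Lemma Xi_lin_u (M : lmodType R) (fv fu fw : nat -> nat -> M) :
  Xi_lin fv fu fw (u_ i j) = fu i j.
Proof. by rewrite /Xi_lin /= lin2_basis !linear0 add0r addr0. Qed.

Lemma Xi_lin_w (M : lmodType R) (fv fu fw : nat -> nat -> M) :
  Xi_lin fv fu fw (w_ i j) = fw i j.
Proof. by rewrite /Xi_lin /= lin2_basis !linear0 !add0r. Qed.

End OnBasis.

Fact iota0_is_linear : linear iota0.
Proof.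
by move=> c a b; rewrite /iota0; congr (_, _, _) => /=; rewrite scaler0 addr0.
Qed.

HB.instance Definition _ :=
  GRing.isLinear.Build R 'M[R]_k Xi *:%R iota0 iota0_is_linear.

Lemma lin2_iota0 (N : 'M[R]_k) (t : 'M[R]_k) :
  lin2 (fun i j => iota0 (tens (N *m vv i) (vv j))) t = iota0 (N *m t).
Proof.
rewrite {2}[t]matrix_sum_delta mulmx_sumr raddf_sum; apply: eq_bigr => i _.
rewrite mulmx_sumr raddf_sum; apply: eq_bigr => j _.
rewrite -scalemxAr -tens_basis /tens (mulmxA N (vv i)).
by do 2?[apply: injective_projections] => /=; rewrite ?scaler0.
Qed.

(* On V (x) V the maps are Y_V (x) 1, X_V (x) 1 and E_V (x) 1. *)
Lemma Ybar_iota0 t : Ybar (iota0 t) = iota0 (YV *m t).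
Proof. by rewrite /Ybar /Xi_lin /= !linear0 !addr0 lin2_iota0. Qed.

Lemma Xbar_iota0 t : Xbar (iota0 t) = iota0 (XV *m t).
Proof. by rewrite /Xbar /Xi_lin /= !linear0 !addr0 lin2_iota0. Qed.

Lemma Ebar_iota0 t : Ebar (iota0 t) = iota0 (EV *m t).
Proof. by rewrite /Ebar /Xi_lin /= !linear0 !addr0 lin2_iota0. Qed.

Lemma Ebar_uE (i j : 'I_k) : Ebar (u_ i j) = Ebar_u i j.
Proof. exact: Xi_lin_u. Qed.

Lemma Ybar_wE (i j : 'I_k) :
  Ybar (w_ i j) = Wbar (u_ i j.+1) + delta q *: u_ 1 (i + j)
                  - delta q *: Ybar (Xbar (v_ i j)).
Proof.
by rewrite [LHS]Xi_lin_w Xbar_iota0 Ybar_iota0 /tens (mulmxA XV (vv i))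
           (mulmxA YV (XV *m vv i)).
Qed.

Lemma V_lin_basis (f : nat -> 'cV[R]_k) i :
  (i < k)%N -> V_lin f *m V_basis i = f i.
Proof.
move=> ltik; apply/colP => a; rewrite !mxE (bigD1 (Ordinal ltik)) //= !mxE.
rewrite eqxx mulr1 big1 ?addr0 // => j; rewrite -val_eqE !mxE /= => /negbTE ->.
by rewrite mulr0.
Qed.

(* The inverse [invmx YV] is a genuine one. *)
Lemma YV_unitmx : (0 < k)%N -> qs 0%N \is a GRing.unit -> YV \in unitmx.
Proof.
move=> k0 q0U.
have YVS i : (i.+1 < k)%N -> YV *m V_basis i = V_basis i.+1.
  by move=> ltik; rewrite V_lin_basis ?(ltnW ltik) // ltik.
have YVl : YV *m V_basis k.-1 = \sum_(j < k) qs j *: V_basis j.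
  by rewrite V_lin_basis ?prednK // ltnn.
pose c0 : 'cV[R]_k :=
  (qs 0%N)^-1 *: (V_basis k.-1 - \sum_(1 <= i < k) qs i *: V_basis i.-1).
have YVc0 : YV *m c0 = V_basis 0.
  rewrite -scalemxAr mulmxBr YVl mulmx_sumr.
  rewrite -(big_mkord xpredT (fun j => qs j *: V_basis j)) big_ltn //.
  rewrite [X in _ - X](eq_big_nat _ _ (F2 := fun i => qs i *: V_basis i)).
    by rewrite addrK scalerA mulVr // scale1r.
  by case=> // i /andP[_ ltik]; rewrite -scalemxAr /= YVS.
pose g j := if j == 0%N then c0 else V_basis j.-1.
suffices YVg : YV *m V_lin g = 1%:M by have [] := mulmx1_unit YVg.
apply/matrixP => a j.
transitivity ((YV *m g j) a 0).
  by rewrite !mxE; apply: eq_bigr => b _; rewrite [V_lin g b j]mxE.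
have -> : YV *m g j = V_basis j.
  rewrite /g; case: j => -[|j] ltjk //=.
  by rewrite YVS.
by rewrite !mxE val_eqE.
Qed.

End Presentation.

Section FreeModules.
Variables (R : pzRingType) (M : lmodType R).

Definition is_basis (I : finType) (b : I -> M) : Prop :=
  (forall c : I -> R, \sum_i c i *: b i = 0 -> forall i, c i = 0)
  /\ (forall x, exists c : I -> R, x = \sum_i c i *: b i).

Definition free_of_rank (n : nat) : Prop := exists b : 'I_n -> M, is_basis b.

End FreeModules.

(* Main.v *)
Require Import Defs.
From HB Require Import structures.
From mathcomp Require Import all_boot all_algebra.
From mathcomp Require Import boolp zify ring.

Set Implicit Arguments.
Unset Strict Implicit.
Unset Printing Implicit Defensive.

Import GRing.Theory.

Local Open Scope ring_scope.

(** The 3 k^2 elements are the images under phi of the standard basis of Xi, so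
    everything follows once Xi is known to be a module and phi to be a bijective
    module morphism.

    The algebra side is short. In the algebra, X Y X commutes with Y and
    X Y X e = Y^-1 e, whence X Y^i e satisfies the very recursion that defines
    X_V v_i ([bX_evalY_be], and its mirror image [be_evalY_bX]). Together with the
    skein relation this shows that phi intertwines the maps on Xi with left
    multiplication by the generators ([phi_Ebar], [phi_Xbar], [phi_Wbar],
    [phi_Ybar]). For x0 := W u_{0,0} one has phi x0 = X^-1 X = 1, and the element
    Y^i e Y^j (resp. Y^i X Y^j, X Y^i X Y^j) carries x0 to v_{i,j} (resp.
    u_{i,j}, w_{i,j}). Hence b |-> b x0 is a two-sided inverse of phi.

    The work lies in proving that Xi is a module. The first step is V. With
    W := X_V - delta + delta E_V, the recursion for X_V says that Y X Y and W agree
    on v_0, ..., v_{k-2}. On v_{k-1} the equation is a linear relation between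
    shifts of the v_s, and the admissibility equations are exactly what makes it
    hold modulo the degree-k relation of Y ([admissible_sum],
    [admissible_WV], [YXY_WV]). Writing E_V = v_0 a with a row vector a, the two
    sides of the braid relation then differ by delta v_0 f, where
    f := lambda a - a X_V. Comparing the top coefficients of (X Y X - Y^-1) v_k with
    those forced by the degree-k relation kills delta f, and so f because delta is
    regular. This gives E X = lambda E, X Y X = Y^-1 and X W = 1 ([EV_XV], [XYX_V],
    [XV_WV]).

    The second step is Xi = (V (x) V)^3. All maps commute with 1 (x) Y, and in terms
    of the operators Y, X, E, W (x) 1, rho := 1 (x) Y and the projection
    mu : v_i (x) v_j |-> v_0 (x) v_{i+j} they are explicit 3 x 3 block operators
    ([EbarE], [XbarE], [WbarE], [YbarE]), so every relation except the degree-k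
    one is a block computation. For the degree-k polynomial P in Y one argues
    structurally: P kills the first two summands and W u_{0,j}, it commutes with
    Z := X Y X, and w_{i+1,j} = Z W u_{i,j} ([Ybar_pow_k]). *)

(** * A summation identity *)

Section Sums.
Variable M : zmodType.
Implicit Type F : nat -> M.

(** Turns nested ranges with dependent bounds into sums over a fixed square, where
    the order of summation can be exchanged. *)
Lemma sum_nat_cond N a b F : (b <= N)%N ->
  \sum_(a <= i < b) F i = \sum_(i < N | (a <= i < b)%N) F i.
Proof.
move=> leb; rewrite (big_nat_widenl _ 0) // (big_nat_widen _ _ N) // big_mkord.
by apply: eq_bigl => i; rewrite ?andbT.
Qed.

Lemma sum_nat_sub c a b F : (b <= c.+1)%N ->
  \sum_(a <= l < b) F (c - l)%N = \sum_(c.+1 - b <= j < c.+1 - a) F j.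
Proof.
move=> leb; have [leba|ltab] := leqP b a.
  by rewrite !big_geq //; lia.
rewrite [RHS]big_nat_rev -{1}[a]add0n big_addn.
rewrite -{1}[(c.+1 - b)%N]add0n big_addn.
have -> : (c.+1 - a - (c.+1 - b) = b - a)%N by lia.
by apply: eq_big_nat => i /andP[_ lti]; congr F; lia.
Qed.

End Sums.

Section ShiftedRelation.
Variables (R : comPzRingType) (M : lmodType R) (k : nat) (Q : nat -> R) (v : nat -> M).
Hypothesis k_gt0 : (0 < k)%N.
Hypothesis Qk : Q k = -1.
Hypothesis Qv : forall c, \sum_(0 <= j < k.+1) Q j *: v (c + j)%N = 0.

(** Summing [T i j] over all j gives the degree-k relation shifted by k - 2 i; the
    three double sums below are pieces of these rows. *)
Let T i j := Q j *: v (k + j - 2 * i)%N.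

Let T_row i a : (a <= k.+1)%N -> (2 * i <= k)%N ->
  \sum_(0 <= j < a) T i j + \sum_(a <= j < k.+1) T i j = 0.
Proof.
move=> leak lei; rewrite -big_cat_nat //= -[RHS](Qv (k - 2 * i)).
by apply: eq_bigr => j _; rewrite /T; congr (_ *: v _); lia.
Qed.

(** All terms are of the form Q_j v_{k+j-2i}. The first double sum contributes, for
    each row i in [1, k), the columns j > i. In the second family the part with
    minus sign contributes the columns j > i of the rows i >= z, the isolated term
    in v_k being its missing l = 0 summand; the part with plus sign contributes
    the columns j <= i of the rows i < z. What is left is the sum of the full rows
    1 <= i < z, each of which is a shifted relation. *)
Lemma admissible_sum :
  (1 - (odd k)%:R) *: v k
  + \sum_(1 <= j < k.+1) Q j *: (\sum_(1 <= s < j) v (k - j + 2 * s)%N)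
  + \sum_(1 <= l < k)
      (- (\sum_(maxn l.+1 (uphalf k) <= i < ((l + k)./2).+1) Q (2 * i - l)%N)
       + \sum_(uphalf l <= i < (minn l (uphalf k).-1).+1) Q (2 * i - l)%N)
      *: v (k - l)%N = 0.
Proof.
set z := uphalf k.
have T1E : \sum_(1 <= j < k.+1) Q j *: (\sum_(1 <= s < j) v (k - j + 2 * s)%N)
    = \sum_(1 <= i < k) \sum_(i.+1 <= j < k.+1) T i j.
  transitivity (\sum_(1 <= j < k.+1) \sum_(1 <= i < j) T i j).
    apply: eq_big_nat => j /andP[j1 jk]; rewrite scaler_sumr.
    rewrite (eq_big_nat _ _ (F2 := fun s => T (j - s)%N j)); last first.
      by move=> s /andP[s1 sj]; rewrite /T; congr (_ *: v _); lia.
    rewrite (sum_nat_sub 1 (fun i => T i j)) //.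
    by congr (\sum_(_ <= _ < _) _); lia.
  transitivity (\sum_(j < k.+1 | (1 <= j < k.+1)%N)
                   \sum_(i < k.+1 | (1 <= i < j)%N) T i j).
    rewrite (@sum_nat_cond _ k.+1) //; apply: eq_bigr => j _.
    by rewrite (@sum_nat_cond _ k.+1) // ltnW.
  rewrite (exchange_big_dep (fun i : 'I_k.+1 => (1 <= i < k)%N)) /=; last by lia.
  rewrite (@sum_nat_cond _ k.+1) //; apply: eq_bigr => i ik.
  by rewrite (@sum_nat_cond _ k.+1) //; apply: eq_bigl => j; lia.
have T2E : \sum_(0 <= l < k)
      (\sum_(maxn l.+1 z <= i < ((l + k)./2).+1) Q (2 * i - l)%N) *: v (k - l)%N
    = \sum_(z <= i < k) \sum_(i.+1 <= j < k.+1) T i j.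
  transitivity (\sum_(l < k.+1 | (0 <= l < k)%N)
      \sum_(i < k.+1 | (maxn l.+1 z <= i < ((l + k)./2).+1)%N) T i (2 * i - l)%N).
    rewrite (@sum_nat_cond _ k.+1) //; apply: eq_bigr => l lk.
    rewrite (@sum_nat_cond _ k.+1); last by lia.
    rewrite scaler_suml; apply: eq_bigr => i il; rewrite /T.
    by congr (_ *: v _); lia.
  rewrite (exchange_big_dep (fun i : 'I_k.+1 => (z <= i < k)%N)) /=; last by lia.
  rewrite (@sum_nat_cond _ k.+1) //; apply: eq_bigr => i ik.
  transitivity (\sum_(2 * i - k <= l < i) T i (2 * i - l)%N).
    by rewrite (@sum_nat_cond _ k.+1); [apply: eq_bigl => l; lia | lia].
  rewrite sum_nat_sub; last by lia.
  by congr (\sum_(_ <= _ < _) _); lia.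
have T3E : \sum_(1 <= l < k)
      (\sum_(uphalf l <= i < (minn l z.-1).+1) Q (2 * i - l)%N) *: v (k - l)%N
    = \sum_(1 <= i < z) \sum_(0 <= j < i.+1) T i j.
  transitivity (\sum_(l < k.+1 | (1 <= l < k)%N)
      \sum_(i < k.+1 | (uphalf l <= i < (minn l z.-1).+1)%N) T i (2 * i - l)%N).
    rewrite (@sum_nat_cond _ k.+1) //; apply: eq_bigr => l lk.
    rewrite (@sum_nat_cond _ k.+1); last by lia.
    rewrite scaler_suml; apply: eq_bigr => i il; rewrite /T.
    by congr (_ *: v _); lia.
  rewrite (exchange_big_dep (fun i : 'I_k.+1 => (1 <= i < z)%N)) /=; last by lia.
  rewrite (@sum_nat_cond _ k.+1); last by lia.
  apply: eq_bigr => i ik.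
  transitivity (\sum_(i <= l < (2 * i).+1) T i (2 * i - l)%N).
    by rewrite (@sum_nat_cond _ k.+1); [apply: eq_bigl => l; lia | lia].
  rewrite sum_nat_sub //.
  by congr (\sum_(_ <= _ < _) _); lia.
(* For l = 0 the inner range is empty for odd k, and is i = z for even k. *)
have T2_0 : \sum_(maxn 1 z <= i < ((0 + k)./2).+1) Q (2 * i - 0)%N
    = - (1 - (odd k)%:R).
  case ok: (odd k); rewrite /= ?mulr0n ?mulr1n ?subrr ?oppr0 ?subr0.
    by rewrite big_geq //; lia.
  have -> : maxn 1 z = k./2 by lia.
  rewrite big_nat1 (_ : (2 * k./2 - 0 = k)%N); last by lia.
  by rewrite Qk addr0.
rewrite big_ltn // T2_0 subn0 in T2E.
rewrite T1E (eq_bigr _ (fun l _ => scalerDl _ _ _)) big_split /= T3E.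
rewrite (eq_bigr _ (fun l _ => scaleNr _ _)) sumrN.
move/(canRL (addKr _)): T2E; rewrite scaleNr opprK => ->.
rewrite (big_cat_nat (n := z)) /=; [|lia|lia].
have cancel (a b c d : M) : a + (b + c) + (- (a + c) + d) = d + b.
  by rewrite (addrCA a) -addrA addNKr addrC.
rewrite cancel -big_split /= big_nat big1 // => i iz.
rewrite T_row //; lia.
Qed.

End ShiftedRelation.

(** * The module V *)

Section ModuleV.
Variables (R : comUnitRingType) (k : nat) (q lam : R) (A qs : nat -> R).
Hypothesis k_gt0 : (0 < k)%N.

Local Notation d := (delta q).
Local Notation v := (vv k qs).
Local Notation Y := (YV k qs).
Local Notation Y' := (invmx Y).
Local Notation X := (XV k q lam A qs).
Local Notation E := (EV k A qs).

(** The operator that the skein relation forces to be the inverse of [XV]. *)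
Definition WV : 'M[R]_k := X - d *: 1%:M + d *: E.
Local Notation W := WV.

Lemma YV_vv i : Y *m v i = v i.+1.
Proof. by rewrite /vv mulmxA exprS. Qed.

Lemma YV_pow_vv i j : Y ^+ i *m v j = v (i + j).
Proof. by rewrite /vv mulmxA exprD. Qed.

Lemma XV_vv i : (i < k)%N -> X *m v i = XVv k q lam A qs i.
Proof. by move=> ik; rewrite [v i]vv_basis // V_lin_basis. Qed.

Lemma EV_vv i : (i < k)%N -> E *m v i = A i *: v 0.
Proof. by move=> ik; rewrite [v i]vv_basis // V_lin_basis. Qed.

Lemma vv_k : v k = \sum_(j < k) qs j *: v j.
Proof.
have -> : v k = Y *m v k.-1 by rewrite YV_vv prednK.
rewrite [v k.-1]vv_basis ?ltn_predL //.
rewrite V_lin_basis ?prednK ?ltnn //.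
by apply: eq_bigr => j _; rewrite vv_basis.
Qed.

Lemma qext_rel c : \sum_(0 <= j < k.+1) qext k qs j *: v (c + j) = 0.
Proof.
rewrite big_nat_recr //= {2}/qext eqxx scaleN1r; apply/eqP; rewrite subr_eq0.
rewrite -YV_pow_vv vv_k mulmx_sumr big_mkord; apply/eqP/eq_bigr => j _.
by rewrite -scalemxAr YV_pow_vv /qext ltn_eqF.
Qed.

Lemma mulmx_vv_inj m (M N : 'M[R]_(m, k)) :
  (forall i, (i < k)%N -> M *m v i = N *m v i) -> M = N.
Proof.
move=> MN; apply/matrixP => a b; have /colP/(_ a) := MN b (ltn_ord b).
have mulv (P : 'M[R]_(m, k)) : (P *m v b) a 0 = P a b.
  rewrite vv_basis // mxE (bigD1 b) //= mxE eqxx mulr1 big1 ?addr0 // => c ncb.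
  by rewrite mxE val_eqE (negbTE ncb) mulr0.
by rewrite !mulv.
Qed.

Hypothesis q0_unit : qs 0%N \is a GRing.unit.
Hypothesis lam_unit : lam \is a GRing.unit.

Let mulY'Y : Y' *m Y = 1%:M. Proof. by rewrite mulVmx // YV_unitmx. Qed.
Let mulYY' : Y *m Y' = 1%:M. Proof. by rewrite mulmxV // YV_unitmx. Qed.

Lemma YV_pow_inj i : injective (fun u : 'cV[R]_k => Y ^+ i *m u).
Proof.
elim: i => [|i IHi] u w; first by rewrite !mul1mx.
rewrite exprSr -!mulmxA => /IHi /(congr1 (mulmx Y')).
by rewrite !mulmxA mulY'Y !mul1mx.
Qed.

Hypothesis lamE : lam - lam^-1 = d * (1 - A 0%N).

Lemma lamVE : lam^-1 = lam - d * (1 - A 0%N).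
Proof. by rewrite -lamE subKr. Qed.

Lemma WV_v0 : W *m v 0 = lam^-1 *: v 0.
Proof.
rewrite mulmxDl mulmxBl -!scalemxAl mul1mx EV_vv // XV_vv //=.
by rewrite scalerA -scalerBl -scalerDl; congr (_ *: _); rewrite lamVE; ring.
Qed.

Lemma WVE i : (i < k)%N ->
  W *m v i = X *m v i - d *: v i + (d * A i) *: v 0.
Proof.
by move=> ik; rewrite mulmxDl mulmxBl -!scalemxAl mul1mx EV_vv // scalerA.
Qed.

Lemma YXY_vv i : (i.+1 < k)%N -> Y *m (X *m v i.+1) = W *m v i.
Proof.
move=> ik; rewrite XV_vv //; case: i ik => [|i] ik.
  by rewrite /= -scalemxAr (mulmxA Y) mulYY' mul1mx WV_v0.
rewrite (_ : XVv _ _ _ _ _ _ = Y' *m XVv k q lam A qs i.+1 - d *: v i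
                               + (d * A i.+1) *: (Y' *m v 0)) //.
rewrite mulmxDr mulmxBr -!scalemxAr !(mulmxA Y Y') mulYY' !mul1mx YV_vv.
by rewrite -XV_vv ?WVE // ltnW.
Qed.

(** Multiplying by a power of Y clears the negative indices in the solution
    W v_i = lambda^-1 v_{-i} - delta sum_s v_{2s-i} + delta sum_s A_s v_{s-i}
    of the recursion. *)
Lemma YV_pow_WV_vv i : (i < k)%N ->
  Y ^+ i *m (W *m v i) =
    lam^-1 *: v 0 - d *: (\sum_(1 <= s < i.+1) v (2 * s))
    + d *: (\sum_(1 <= s < i.+1) A s *: v s).
Proof.
elim: i => [|i IHi] ik.
  by rewrite expr0 mul1mx WV_v0 !big_geq // !scaler0 subr0 addr0.
rewrite WVE // mulmxDr mulmxBr -!scalemxAr !YV_pow_vv addn0.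
rewrite exprSr -mulmxA YXY_vv // IHi; last exact: ltnW.
rewrite !(@big_nat_recr _ _ _ i.+1) //= (_ : i.+1 + i.+1 = 2 * i.+1)%N; last by lia.
move: (\sum_(_ <= _ < _) _) (\sum_(_ <= _ < _) _) => S T.
by apply/colP => a; rewrite !mxE; ring.
Qed.

Hypothesis adm_h0 : forall l, (1 <= l <= k.-1)%N -> adm_h k q lam A qs l = 0.
Hypothesis adm_beta0 : adm_beta k q lam qs = 0.

Local Notation Q := (qext k qs).

(** This is q_0 (lambda v_1 - W v_{-1}) = 0 with v_{-1} expanded by the degree-k
    relation. Up to sums of q's that cancel by [admissible_sum], the coefficient of
    v_{1-l} is h_l and that of v_1 is beta. *)
Lemma admissible_WV :
  \sum_(1 <= i < k.+1) Q i *: (W *m v i.-1) + (qs 0%N * lam) *: v 1 = 0.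
Proof.
apply: (@YV_pow_inj k.-1); rewrite mulmx0 mulmxDr mulmx_sumr -scalemxAr YV_pow_vv addn1 prednK //.
(* Multiplication by Y^(k-1) makes every index nonnegative. *)
have WE i : (0 < i < k.+1)%N -> Y ^+ k.-1 *m (Q i *: (W *m v i.-1)) =
    (lam^-1 * Q i) *: v (k - i)
    - d *: (Q i *: (\sum_(1 <= s < i) v (k - i + 2 * s)%N))
    + d *: (\sum_(1 <= s < i) (Q i * A s) *: v (k - i + s)%N).
  case/andP=> i0 ik; rewrite -scalemxAr (_ : k.-1 = k - i + i.-1)%N; last by lia.
  rewrite exprD -mulmxA YV_pow_WV_vv ?prednK //.
  rewrite mulmxDr mulmxBr -!scalemxAr YV_pow_vv addn0 !mulmx_sumr.
  have -> : \sum_(1 <= s < i) Y ^+ (k - i) *m v (2 * s)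
          = \sum_(1 <= s < i) v (k - i + 2 * s)%N.
    by apply: eq_bigr => s _; rewrite YV_pow_vv.
  have -> : \sum_(1 <= s < i) Y ^+ (k - i) *m (A s *: v s)
          = \sum_(1 <= s < i) A s *: v (k - i + s)%N.
    by apply: eq_bigr => s _; rewrite -scalemxAr YV_pow_vv.
  have -> : \sum_(1 <= s < i) (Q i * A s) *: v (k - i + s)%N
          = \sum_(1 <= s < i) Q i *: (A s *: v (k - i + s)%N).
    by apply: eq_bigr => s _; rewrite scalerA.
  rewrite -scaler_sumr; move: (\sum_(_ <= _ < _) _) (\sum_(_ <= _ < _) _) => S T.
  by apply/colP => a; rewrite !mxE; ring.
rewrite (eq_big_nat _ _ WE) !big_split /= sumrN -!scaler_sumr.
(* Collect the coefficient of v_{k-l}, with l = i - s. *)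
have AE : \sum_(1 <= i < k.+1) \sum_(1 <= s < i) (Q i * A s) *: v (k - i + s)%N
   = \sum_(1 <= l < k) (\sum_(1 <= r < (k - l).+1) Q (r + l)%N * A r) *: v (k - l)%N.
  transitivity (\sum_(i < k.+1 | (1 <= i < k.+1)%N)
       \sum_(s < k.+1 | (1 <= s < i)%N) (Q i * A s) *: v (k - i + s)%N).
    rewrite (@sum_nat_cond _ k.+1) //; apply: eq_bigr => i _.
    by rewrite (@sum_nat_cond _ k.+1) // ltnW.
  rewrite (exchange_big_dep (fun s : 'I_k.+1 => (1 <= s < k)%N)) /=; last by lia.
  transitivity (\sum_(l < k.+1 | (1 <= l < k)%N)
       \sum_(s < k.+1 | (1 <= s < (k - l).+1)%N) (Q (s + l)%N * A s) *: v (k - l)%N);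
    last first.
    rewrite [RHS](@sum_nat_cond _ k.+1) //; apply: eq_bigr => l _.
    by rewrite scaler_suml [RHS](@sum_nat_cond _ k.+1) //; lia.
  rewrite [RHS](exchange_big_dep (fun s : 'I_k.+1 => (1 <= s < k)%N)) /=; last by lia.
  apply: eq_bigr => s sk.
  transitivity (\sum_(s.+1 <= i < k.+1) (Q i * A s) *: v (k - i + s)%N).
    by rewrite (@sum_nat_cond _ k.+1) //; apply: eq_bigl => i; lia.
  transitivity (\sum_(1 <= l < (k - s).+1) (Q (s + l)%N * A s) *: v (k - l)%N).
    rewrite -[s.+1]add1n big_addn (_ : k.+1 - s = (k - s).+1)%N; last by lia.
    by apply: eq_big_nat => l lk; rewrite (addnC l); congr (_ *: v _); lia.
  by rewrite (@sum_nat_cond _ k.+1); [apply: eq_bigl => i; lia | lia].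
pose B l := - (\sum_(maxn l.+1 (uphalf k) <= i < ((l + k)./2).+1) Q (2 * i - l)%N)
  + \sum_(uphalf l <= i < (minn l (uphalf k).-1).+1) Q (2 * i - l)%N.
have adm_sum : \sum_(1 <= l < k) B l *: v (k - l)%N
    = - ((1 - (odd k)%:R) *: v k
         + \sum_(1 <= j < k.+1) Q j *: (\sum_(1 <= s < j) v (k - j + 2 * s)%N)).
  apply/eqP; rewrite -addr_eq0 addrC; apply/eqP.
  by apply: admissible_sum qext_rel => //; rewrite /qext eqxx.
(* The term q_0^-1 q_{k-l} of h_l has no counterpart in W; it is absorbed by the
   degree-k relation itself, at the cost of terms in v_k and v_0. *)
have Qrev : \sum_(1 <= l < k) Q (k - l)%N *: v (k - l)%N = v k - qs 0%N *: v 0.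
  have := qext_rel 0; rewrite big_nat_recr // big_ltn //= {1 3}/qext eqxx ltn_eqF //.
  rewrite scaleN1r => /eqP; rewrite subr_eq0 => /eqP <-; rewrite addrC addrK.
  by rewrite (sum_nat_sub 1 (fun j => Q j *: v j)) // subSnn subn1.
have -> : d *: (\sum_(1 <= i < k.+1) \sum_(1 <= s < i) (Q i * A s) *: v (k - i + s)%N)
    = - lam^-1 *: (\sum_(1 <= l < k) Q l *: v (k - l)%N)
      - (lam^-1 * (qs 0%N)^-1) *: (\sum_(1 <= l < k) Q (k - l)%N *: v (k - l)%N)
      - d *: (\sum_(1 <= l < k) B l *: v (k - l)%N).
  rewrite AE !scaler_sumr -!sumrN -!big_split /=; apply: eq_big_nat => l lk.
  have := @adm_h0 l; rewrite /adm_h => /(_ _); rewrite /B /adm_z.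
  move: (\sum_(_ <= _ < _) _) (\sum_(_ <= _ < _) _) (\sum_(_ <= _ < _) _) => S1 S2 S3.
  move=> hl; rewrite !scalerA -!scalerBl; congr (_ *: _).
  apply/eqP; rewrite -subr_eq0 -hl; last by lia.
  by apply/eqP; ring.
rewrite adm_sum Qrev big_nat_recr //= subnn {2}/qext eqxx.
rewrite (eq_bigr (fun i => lam^-1 *: (Q i *: v (k - i)%N))) => [|i _]; last by rewrite scalerA.
rewrite -scaler_sumr.
have -> : qs 0%N * lam = (qs 0%N)^-1 * lam^-1 - (1 - (odd k)%:R) * d.
  apply/eqP; rewrite -subr_eq0 -adm_beta0 /adm_beta /adm_epsilon; apply/eqP.
  by ring.
move: (\sum_(_ <= _ < _) _) (\sum_(_ <= _ < _) _) => S1 S2.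
apply/colP => a; rewrite !mxE.
have := mulVr q0_unit; move: (qs 0%N) (_^-1) lam^-1 => q0 q0' l' q0E.
ring: q0E.
Qed.

(** On v_{k-1} the claim is [admissible_WV], the value of X at v_k being obtained
    from the degree-k relation. *)
Lemma YXY_WV : Y *m X *m Y = W.
Proof.
apply: mulmx_vv_inj => i ik; rewrite -!mulmxA YV_vv.
have [ik1|] := ltnP i.+1 k; first exact: YXY_vv.
move=> ki; have -> : i = k.-1 by lia.
rewrite prednK // vv_k !mulmx_sumr.
rewrite -(big_mkord xpredT (fun j => Y *m (X *m (qs j *: v j)))) big_ltn //.
have := admissible_WV; rewrite big_nat_recr //= {2}/qext eqxx scaleN1r.
rewrite addrAC => /eqP; rewrite subr_eq0 => /eqP <-; rewrite addrC.
congr (_ + _).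
  by rewrite -!scalemxAr XV_vv //= -scalemxAr YV_vv scalerA.
apply: eq_big_nat => -[//|j] /andP[_ jk].
by rewrite -!scalemxAr YXY_vv // /qext ltn_eqF.
Qed.

Lemma XV_EV : X *m E = lam *: E.
Proof.
apply: mulmx_vv_inj => i ik; rewrite -scalemxAl -mulmxA EV_vv // -scalemxAr.
by rewrite XV_vv //= !scalerA mulrC.
Qed.

Hypothesis delta_reg : GRing.lreg d.

(** E = v_0 a, so that E X = lambda E amounts to f = 0. *)
Let a : 'rV[R]_k := \row_i A i.
Let f : 'rV[R]_k := lam *: a - a *m X.
Let Z := X *m Y *m X.

Let EV_outer : E = v 0 *m a.
Proof. by apply/matrixP => i j; rewrite !mxE big_ord1 !mxE mulrC. Qed.

Let ZY_comm : Z *m Y = Y *m Z + d *: (v 0 *m f).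
Proof.
have -> : Z *m Y = X *m W by rewrite -YXY_WV /Z !mulmxA.
have -> : Y *m Z = W *m X by rewrite -YXY_WV /Z !mulmxA.
rewrite /f mulmxBr -scalemxAr (mulmxA (v 0)) -EV_outer /W.
rewrite !(mulmxDr, mulmxDl, mulmxN, mulNmx) -!(scalemxAr, scalemxAl) mul1mx mulmx1.
rewrite XV_EV; move: (X *m X) (E *m X) => XX EX.
by apply/matrixP => i j; rewrite !mxE; ring.
Qed.

Let ZY'_v0 : (Z - Y') *m v 0 = 0.
Proof.
apply/eqP; rewrite mulmxBl subr_eq0 /Z -!mulmxA XV_vv //= -!scalemxAr.
have <- : Y' *m (Y *m (X *m (Y *m v 0))) = X *m (Y *m v 0).
  by rewrite (mulmxA Y') mulY'Y mul1mx.
have -> : Y *m (X *m (Y *m v 0)) = W *m v 0 by rewrite -YXY_WV -!mulmxA.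
by rewrite WV_v0 -scalemxAr scalerA mulrV // scale1r.
Qed.

(** The commutator of Z - Y^-1 with Y is delta v_0 f and Z - Y^-1 kills v_0, so its
    value at v_n only involves the numbers f(v_s), s < n. *)
Let ZY'_vv n : (Z - Y') *m v n =
  d *: \sum_(0 <= s < n) (f *m v s) 0 0 *: v (n.-1 - s)%N.
Proof.
elim: n => [|n IHn]; first by rewrite ZY'_v0 big_geq // scaler0.
have ->: (Z - Y') *m v n.+1 = Y *m ((Z - Y') *m v n) + d *: (v 0 *m (f *m v n)).
  rewrite -YV_vv mulmxA mulmxBl ZY_comm mulY'Y -mulYY' (mulmxA Y) (mulmxBr Y).
  by rewrite (mulmxA _ f) (scalemxAl d (v 0 *m f)) -mulmxDl addrAC.
rewrite big_nat_recr //= subnn scalerDr IHn -scalemxAr mulmx_sumr.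
congr (d *: _ + d *: _).
  apply: eq_big_nat => s sn; rewrite -scalemxAr YV_vv; congr (_ *: v _); lia.
have [c ->] : exists c, f *m v n = c%:M by exists ((f *m v n) 0 0); apply: mx11_scalar.
by rewrite mul_mx_scalar mxE eqxx mulr1n.
Qed.

(** If f vanishes at v_t for t < s, the entry of index k - 1 - s of (Z - Y^-1) v_n is
    delta f(v_s) for n = k and 0 for n < k. As v_k is a combination of the v_n with
    n < k, delta f(v_s) = 0. *)
Let f0 : f = 0.
Proof.
apply: mulmx_vv_inj => s; rewrite mul0mx; elim/ltn_ind: s => s IHs sk.
suff fs0 : (f *m v s) 0 0 = 0 by apply/matrixP => i j; rewrite !ord1 fs0 mxE.
have mk : (k.-1 - s < k)%N by lia.
pose m := Ordinal mk.
have vm i : (i < k)%N -> v i m 0 = (i == m)%:R.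
  by move=> ik; rewrite vv_basis // mxE eq_sym.
have entry n : (n <= k)%N -> ((Z - Y') *m v n) m 0
    = if n == k then d * (f *m v s) 0 0 else 0.
  move=> nk; rewrite ZY'_vv mxE summxE.
  case: eqP => nkE.
    rewrite nkE (bigD1_seq s) ?mem_iota ?iota_uniq //=; last by lia.
    rewrite mxE vm ?eqxx ?mulr1 // big1_seq ?addr0 // => t /andP[nts].
    rewrite mem_index_iota => tk; rewrite mxE vm /=; last by lia.
    by rewrite (_ : _ == _ = false) ?mulr0 //; lia.
  rewrite big_nat big1 ?mulr0 // => t tn; rewrite mxE vm /=; last by lia.
  have [ts|st] := ltnP t s; first by rewrite IHs ?mxE ?mul0r //; lia.
  by rewrite (_ : _ == _ = false) ?mulr0 //; lia.
apply: delta_reg; rewrite mulr0.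
have := entry k (leqnn k); rewrite eqxx => <-.
rewrite vv_k mulmx_sumr summxE big1 // => j _.
by rewrite -scalemxAr mxE entry 1?ltnW // ltn_eqF // mulr0.
Qed.

Lemma EV_XV : E *m X = lam *: E.
Proof.
apply/eqP; rewrite EV_outer -mulmxA scalemxAr eq_sym -subr_eq0 -mulmxBr.
by rewrite -/f f0 mulmx0.
Qed.

(** In the algebra, X Y X Y is central and fixes e, so it has to act as the identity
    on V. Here this follows from Z - Y^-1 vanishing at every v_n, since f = 0. *)
Lemma XYX_V : X *m Y *m X = Y'.
Proof.
apply/eqP; rewrite -subr_eq0; apply/eqP/mulmx_vv_inj => n _.
rewrite ZY'_vv mul0mx big1 ?scaler0 // => s _.
by rewrite f0 mul0mx mxE scale0r.
Qed.

Lemma XV_WV : X *m W = 1%:M.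
Proof. by rewrite -YXY_WV !mulmxA XYX_V mulY'Y. Qed.

Lemma WV_XV : W *m X = 1%:M.
Proof. exact/mulmx1C/XV_WV. Qed.

End ModuleV.

(** * The ring of linear endomorphisms *)

Section Endomorphisms.
Variables (R : comPzRingType) (M : lmodType R).

(** Linearity is stored as a boolean so that two endomorphisms are equal as soon as
    they agree pointwise. *)
Definition lin_endo : Type := {f : M -> M | `[< linear f >]}.

HB.instance Definition _ := gen_eqMixin lin_endo.
HB.instance Definition _ := gen_choiceMixin lin_endo.

Definition lapp (f : lin_endo) : M -> M := sval f.

Fact lapp_is_linear f : linear (lapp f).
Proof. exact/asboolP/(svalP f). Qed.

HB.instance Definition _ f := GRing.isLinear.Build R M M *:%R (lapp f) (lapp_is_linear f).

Definition mk_lin_endo (f : {linear M -> M}) : lin_endo :=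
  exist _ (f : M -> M) (asboolT (linearP f)).

Lemma lin_endoP (f g : lin_endo) : lapp f =1 lapp g -> f = g.
Proof. by case: f g => [f Lf] [g Lg] fg; apply: eq_exist; apply/funext. Qed.

Definition lin_endo_add (f g : lin_endo) := mk_lin_endo (lapp f \+ lapp g).
Definition lin_endo_opp (f : lin_endo) := mk_lin_endo (\- lapp f).
Definition lin_endo_mul (f g : lin_endo) := mk_lin_endo (lapp f \o lapp g).
Definition lin_endo_scal (c : R) := mk_lin_endo (c \*: idfun).

Fact lin_endo_addA : associative lin_endo_add.
Proof. by move=> f g h; apply: lin_endoP => x; apply: addrA. Qed.
Fact lin_endo_addC : commutative lin_endo_add.
Proof. by move=> f g; apply: lin_endoP => x; apply: addrC. Qed.
Fact lin_endo_add0 : left_id (mk_lin_endo \0) lin_endo_add.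
Proof. by move=> f; apply: lin_endoP => x; apply: add0r. Qed.
Fact lin_endo_addN : left_inverse (mk_lin_endo \0) lin_endo_opp lin_endo_add.
Proof. by move=> f; apply: lin_endoP => x; apply: addNr. Qed.

HB.instance Definition _ := GRing.isZmodule.Build lin_endo
  lin_endo_addA lin_endo_addC lin_endo_add0 lin_endo_addN.

Fact lin_endo_mulA : associative lin_endo_mul.
Proof. by move=> f g h; apply: lin_endoP. Qed.
Fact lin_endo_mul1 : left_id (mk_lin_endo idfun) lin_endo_mul.
Proof. by move=> f; apply: lin_endoP. Qed.
Fact lin_endo_mulr1 : right_id (mk_lin_endo idfun) lin_endo_mul.
Proof. by move=> f; apply: lin_endoP. Qed.
Fact lin_endo_mulDl : left_distributive lin_endo_mul +%R.
Proof. by move=> f g h; apply: lin_endoP. Qed.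
Fact lin_endo_mulDr : right_distributive lin_endo_mul +%R.
Proof. by move=> f g h; apply: lin_endoP => x; apply: (raddfD (lapp f)). Qed.

HB.instance Definition _ := GRing.Zmodule_isPzRing.Build lin_endo
  lin_endo_mulA lin_endo_mul1 lin_endo_mulr1 lin_endo_mulDl lin_endo_mulDr.

Fact lin_endo_scal_zmod : zmod_morphism lin_endo_scal.
Proof. by move=> c d; apply: lin_endoP => x; apply: scalerBl. Qed.
Fact lin_endo_scal_monoid : monoid_morphism lin_endo_scal.
Proof.
split=> [|c d]; apply: lin_endoP => x; first exact: scale1r.
exact: esym (scalerA _ _ _).
Qed.

HB.instance Definition _ := GRing.isZmodMorphism.Build R lin_endo lin_endo_scal lin_endo_scal_zmod.
HB.instance Definition _ :=
  GRing.isMonoidMorphism.Build R lin_endo lin_endo_scal lin_endo_scal_monoid.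

Lemma lin_endo_scalC c f : lin_endo_scal c * f = f * lin_endo_scal c.
Proof. by apply: lin_endoP => x; symmetry; apply: (linearZZ (lapp f)). Qed.

Lemma lappM f g x : lapp (f * g) x = lapp f (lapp g x). Proof. by []. Qed.
Lemma lappD f g x : lapp (f + g) x = lapp f x + lapp g x. Proof. by []. Qed.
Lemma lapp_add f u v : lapp f (u + v) = lapp f u + lapp f v.
Proof. exact: linearD. Qed.
Lemma lapp_opp f u : lapp f (- u) = - lapp f u.
Proof. exact: linearN. Qed.
Lemma lapp_scale f c u : lapp f (c *: u) = c *: lapp f u.
Proof. exact: linearZ. Qed.
Lemma lapp_zero f : lapp f 0 = 0.
Proof. exact: linear0. Qed.
Lemma lappN f x : lapp (- f) x = - lapp f x. Proof. by []. Qed.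
Lemma lapp_scal c x : lapp (lin_endo_scal c) x = c *: x. Proof. by []. Qed.
Lemma lapp_sum n (F : 'I_n -> lin_endo) x :
  lapp (\sum_(i < n) F i) x = \sum_(i < n) lapp (F i) x.
Proof. by elim/big_rec2: _ => // i y f _ <-. Qed.

End Endomorphisms.

(** * Operators on the tensor square of V *)

Section Tensor.
Variables (R : comUnitRingType) (k : nat) (qs : nat -> R).
Hypotheses (k_gt0 : (0 < k)%N).

Local Notation v := (vv k qs).
Local Notation Y := (YV k qs).

Lemma lin2E (M : lmodType R) (f : nat -> nat -> M) (g : 'M[R]_k -> M) :
  linear g -> (forall i j : 'I_k, g (tens (v i) (v j)) = f i j) ->
  lin2 f =1 g.
Proof.
move=> Lg gf t; pose g' := GRing.isLinear.Build _ _ _ _ g Lg.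
pose G : {linear 'M[R]_k -> M} := HB.pack g g'.
rewrite -[g t]/(G t) [in RHS](matrix_sum_delta t) linear_sum; apply: eq_bigr => i _.
rewrite linear_sum; apply: eq_bigr => j _.
by rewrite linearZ /= -(tens_basis qs) gf.
Qed.

Lemma linear_tens_ext (M : lmodType R) (f g : 'M[R]_k -> M) :
  linear f -> linear g ->
  (forall i j : 'I_k, f (tens (v i) (v j)) = g (tens (v i) (v j))) -> f =1 g.
Proof.
move=> Lf Lg fg t; pose h i j := g (tens (v i) (v j)).
by rewrite -(@lin2E _ h f) // -(@lin2E _ h g).
Qed.

(** The multiplication v_i (x) v_j |-> v_{i+j} that V carries as the quotient of the
    polynomial ring R[Y] by the degree-k relation. *)
Definition vmul (t : 'M[R]_k) : 'cV[R]_k := \sum_(j < k) Y ^+ j *m col j t.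

Fact vmul_is_linear : linear vmul.
Proof.
move=> c s t; rewrite /vmul scaler_sumr -big_split; apply: eq_bigr => j _ /=.
by rewrite linearP /= mulmxDr -scalemxAr.
Qed.
HB.instance Definition _ := GRing.isLinear.Build R 'M[R]_k 'cV[R]_k *:%R
  vmul vmul_is_linear.

(** The projection v_i (x) v_j |-> v_0 (x) v_{i+j}: the values of [Ebar] lie in its
    image. *)
Definition mu (t : 'M[R]_k) : 'M[R]_k := tens (v 0) (vmul t).

Fact mu_is_linear : linear mu.
Proof. by move=> c s t; rewrite /mu /tens linearP linearP /= linearP. Qed.
HB.instance Definition _ := GRing.isLinear.Build R 'M[R]_k 'M[R]_k *:%R mu mu_is_linear.

(** 1 (x) Y, which will commute with all the operators on Xi: it corresponds to right
    multiplication by Y in the algebra. *)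
Definition rho (t : 'M[R]_k) : 'M[R]_k := t *m Y^T.

Fact rho_is_linear : linear rho.
Proof. by move=> c s t; rewrite /rho mulmxDl scalemxAl. Qed.
HB.instance Definition _ := GRing.isLinear.Build R 'M[R]_k 'M[R]_k *:%R rho rho_is_linear.

Lemma rho_mulmx (N t : 'M[R]_k) : rho (N *m t) = N *m rho t.
Proof. by rewrite /rho mulmxA. Qed.

Lemma rho_tens a b : rho (tens a b) = tens a (Y *m b).
Proof. by rewrite /rho /tens trmx_mul mulmxA. Qed.

Lemma mul_tens N (a b : 'cV[R]_k) : N *m tens a b = tens (N *m a) b.
Proof. exact: mulmxA. Qed.

Lemma YV_pow_k : Y ^+ k = \sum_(i < k) qs i *: Y ^+ i.
Proof.
apply: (@mulmx_vv_inj _ _ qs) => j _; rewrite YV_pow_vv addnC -YV_pow_vv (vv_k _ k_gt0).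
rewrite mulmx_sumr mulmx_suml; apply: eq_bigr => i _.
by rewrite -scalemxAr -scalemxAl !YV_pow_vv addnC.
Qed.

Let col_tens (a b : 'cV[R]_k) j : col j (tens a b) = b j 0 *: a.
Proof. by apply/colP => i; rewrite !mxE big_ord1 !mxE mulrC. Qed.

Let vmul_tens_lt a j : (j < k)%N -> vmul (tens a (v j)) = Y ^+ j *m a.
Proof.
move=> jk; rewrite /vmul (bigD1 (Ordinal jk)) //= big1 ?addr0.
  by rewrite col_tens vv_basis // mxE eqxx scale1r.
move=> i nij; rewrite col_tens vv_basis // mxE.
by rewrite -val_eqE in nij; rewrite (negbTE nij) scale0r mulmx0.
Qed.

(** On v_i (x) v_{k-1} this uses that Y satisfies the degree-k relation as a matrix. *)
Lemma vmul_rho t : vmul (rho t) = Y *m vmul t.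
Proof.
have cY a j : (j < k)%N -> vmul (tens a (v j.+1)) = Y *m vmul (tens a (v j)).
  move=> jk; rewrite (vmul_tens_lt _ jk) mulmxA -[Y *m _]/(Y * _) -exprS.
  have [jk1|kj] := ltnP j.+1 k; first exact: vmul_tens_lt.
  have -> : j.+1 = k by lia.
  rewrite YV_pow_k (vv_k _ k_gt0) mulmx_suml /tens linear_sum mulmx_sumr linear_sum /=.
  apply: eq_bigr => i _; rewrite linearZ -scalemxAr linearZ /= -/(tens _ _).
  by rewrite vmul_tens_lt // scalemxAl.
apply: (@linear_tens_ext _ (vmul \o rho) (mulmx Y \o vmul)); [exact: linearP|exact: linearP|].
by move=> i j /=; rewrite rho_tens YV_vv cY.
Qed.

Lemma vmul_tens a j : vmul (tens a (v j)) = Y ^+ j *m a.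
Proof.
elim: j => [|j IHj]; first exact: vmul_tens_lt.
by rewrite -YV_vv -rho_tens vmul_rho IHj mulmxA -[Y *m _]/(Y * _) -exprS.
Qed.

Lemma vmul_v0 b : vmul (tens (v 0) b) = b.
Proof.
rewrite /vmul; apply/colP => i; rewrite summxE (bigD1 i) //=.
rewrite col_tens -scalemxAr YV_pow_vv addn0 mxE vv_basis // mxE eqxx mulr1.
rewrite big1 ?addr0 // => j nij.
rewrite col_tens -scalemxAr YV_pow_vv addn0 mxE vv_basis // mxE val_eqE eq_sym.
by rewrite (negbTE nij) mulr0.
Qed.

Lemma vmul_YV t : vmul (Y *m t) = Y *m vmul t.
Proof.
rewrite /vmul mulmx_sumr; apply: eq_bigr => j _.
rewrite !colE !mulmxA; congr (_ *m _ *m _).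
by rewrite -[LHS]/(_ * _) -[RHS]/(_ * _) -exprS -exprSr.
Qed.

Lemma mu_rho t : mu (rho t) = rho (mu t).
Proof. by rewrite /mu vmul_rho -rho_tens. Qed.

(** Under the multiplication of V, the two copies of Y become equal. *)
Lemma mu_YV t : mu (Y *m t) = rho (mu t).
Proof. by rewrite /mu vmul_YV -rho_tens. Qed.

Lemma mu_mu t : mu (mu t) = mu t.
Proof. by rewrite /mu vmul_v0. Qed.

Lemma mu_EV (A : nat -> R) t : mu (EV k A qs *m t) = EV k A qs *m t.
Proof.
have -> : EV k A qs *m t = tens (v 0) ((\row_i A i) *m t)^T; last first.
  by rewrite /mu vmul_v0.
rewrite /tens trmxK mulmxA; congr (_ *m _).
by apply/matrixP => i j; rewrite !mxE big_ord1 !mxE mulrC.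
Qed.

Lemma mul_mu N c t : N *m v 0 = c *: v 0 -> N *m mu t = c *: mu t.
Proof. by move=> Nv; rewrite /mu mul_tens Nv /tens scalemxAl. Qed.

Lemma mu_tens i j : mu (tens (v i) (v j)) = tens (v 0) (v (i + j)).
Proof. by rewrite /mu vmul_tens YV_pow_vv addnC. Qed.

End Tensor.

(** * Relations between the operators on Xi *)

Section MatrixEntries.
Variables (R : comPzRingType) (m n : nat).
Implicit Types (M N : 'M[R]_(m, n)).

Lemma entryD M N i j : (M + N) i j = M i j + N i j. Proof. by rewrite mxE. Qed.
Lemma entryN M i j : (- M) i j = - M i j. Proof. by rewrite mxE. Qed.
Lemma entryZ c M i j : (c *: M) i j = c * M i j. Proof. by rewrite mxE. Qed.
Lemma entry0 i j : (0 : 'M[R]_(m, n)) i j = 0. Proof. by rewrite mxE. Qed.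

End MatrixEntries.

(* Reduces an identity between linear combinations of matrices to one in the ground
   ring. Only the linear structure is expanded: matrix products and the values of
   [mu] and [rho] have to remain atoms, which [mxE] would not respect. *)
Local Ltac entrywise :=
  apply/matrixP => ? ?; rewrite ?(entryD, entryN, entryZ, entry0).

Section ModuleXi.
Variables (R : comUnitRingType) (k : nat) (q lam : R) (A qs : nat -> R).

Local Notation d := (delta q).
Local Notation v := (vv k qs).
Local Notation Y := (YV k qs).
Local Notation Y' := (invmx Y).
Local Notation X := (XV k q lam A qs).
Local Notation E := (EV k A qs).
Local Notation W := (WV k q lam A qs).
Local Notation mu := (@mu R k qs).
Local Notation rho := (@rho R k qs).
Local Notation Xi := (Xi R k).
Local Notation Ebar := (@Defs.Ebar R k q lam A qs).
Local Notation Xbar := (@Defs.Xbar R k q lam A qs).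
Local Notation Ybar := (@Defs.Ybar R k q lam A qs).
Local Notation Wbar := (@Defs.Wbar R k q lam A qs).

Lemma XiD (a b c a' b' c' : 'M[R]_k) :
  ((a, b, c) : Xi) + (a', b', c') = (a + a', b + b', c + c').
Proof. by []. Qed.

Lemma XiN (a b c : 'M[R]_k) : - ((a, b, c) : Xi) = (- a, - b, - c).
Proof. by []. Qed.

Lemma XiZ x (a b c : 'M[R]_k) : x *: ((a, b, c) : Xi) = (x *: a, x *: b, x *: c).
Proof. by []. Qed.

Fact xi1_is_linear : linear (@xi1 R k).
Proof. by move=> c a b; rewrite /xi1 XiZ XiD !scaler0 !addr0. Qed.
HB.instance Definition _ := GRing.isLinear.Build R 'M[R]_k Xi *:%R (@xi1 R k) xi1_is_linear.

Fact xi2_is_linear : linear (@xi2 R k).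
Proof. by move=> c a b; rewrite /xi2 XiZ XiD !scaler0 !addr0. Qed.
HB.instance Definition _ := GRing.isLinear.Build R 'M[R]_k Xi *:%R (@xi2 R k) xi2_is_linear.

Fact Wbar_is_linear : linear Wbar.
Proof.
exact: (linearP ((Xbar \- d \*: idfun) \+ d \*: Ebar)).
Qed.
HB.instance Definition _ := GRing.isLinear.Build R Xi Xi *:%R Wbar Wbar_is_linear.

Lemma Xi_lin3 (M : lmodType R) (fv fu fw : nat -> nat -> M) (a b c : 'M[R]_k) :
  Xi_lin fv fu fw (a, b, c) = lin2 fv a + lin2 fu b + lin2 fw c.
Proof. by []. Qed.

Let muD : {morph mu : s t / s + t}. Proof. exact: linearD. Qed.
Let muN : {morph mu : t / - t}. Proof. exact: linearN. Qed.
Let muZ c : {morph mu : t / c *: t}. Proof. exact: linearZ. Qed.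
Let rhoD : {morph rho : s t / s + t}. Proof. exact: linearD. Qed.
Let rhoN : {morph rho : t / - t}. Proof. exact: linearN. Qed.
Let rhoZ c : {morph rho : t / c *: t}. Proof. exact: linearZ. Qed.

Hypothesis k_gt0 : (0 < k)%N.

(** Y^j X Y^i v_0 is the product of X v_i and v_j in V. *)
Lemma Ebar_u_mu (i j : 'I_k) :
  Ebar_u k q lam A qs i j = iota0 (mu (X *m tens (v i) (v j))).
Proof.
rewrite /Ebar_u /mu mul_tens vmul_tens // -!mulmxA.
by rewrite YV_pow_vv addn0.
Qed.

Lemma Ebar_w_scale i j :
  iota0 (tens (v 0) (Y ^+ j *m X *m Y ^+ i *m X *m v 0)) = lam *: Ebar_u k q lam A qs i j.
Proof.
have -> : Y ^+ j *m X *m Y ^+ i *m X *m v 0 = lam *: (Y ^+ j *m X *m Y ^+ i *m v 0).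
  rewrite -[LHS]mulmxA XV_vv //=.
  exact: esym (scalemxAr _ _ _).
by rewrite /tens linearZ /= -scalemxAr linearZ.
Qed.

(** The four maps on Xi as block operators on triples of matrices; X, Y, E and W act
    on the left tensor factor. *)
Lemma EbarE a b c :
  Ebar (a, b, c) = (E *m a + mu (X *m b) + lam *: mu (X *m c), 0, 0).
Proof.
rewrite [LHS]Xi_lin3 lin2_iota0.
rewrite (@lin2E _ _ qs _ (Ebar_u k q lam A qs)
  (@iota0 R k \o mu \o mulmx X)); first last.
- by move=> i j; rewrite Ebar_u_mu.
- exact: linearP.
rewrite (@lin2E _ _ qs _ _ (lam \*: (@iota0 R k \o mu \o mulmx X))); first last.
- by move=> i j; rewrite Ebar_w_scale /= -Ebar_u_mu.
- exact: linearP.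
rewrite -[LHS]/(iota0 (E *m a) + iota0 (mu (X *m b)) + lam *: iota0 (mu (X *m c))).
by rewrite -linearZ -!linearD.
Qed.

Lemma XbarE a b c :
  Xbar (a, b, c) = (X *m a - (d * lam) *: mu (X *m c), c, b + d *: c).
Proof.
rewrite [LHS]Xi_lin3 lin2_iota0.
rewrite (@lin2E _ _ qs _ (fun i j => w_ k qs i j) (@xi2 R k)) //; last exact: linearP.
rewrite (@lin2E _ _ qs _ _ ((@xi1 R k \+ d \*: @xi2 R k)
   \- (d * lam) \*: (@iota0 R k \o mu \o mulmx X))); first last.
- by move=> i j /=; rewrite -Ebar_u_mu.
- exact: linearP.
rewrite /= /iota0 /xi1 /xi2 !XiZ !XiN !XiD.
by congr (_, _, _); entrywise; ring.
Qed.

Lemma WbarE a b c :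
  Wbar (a, b, c) = (W *m a + d *: mu (X *m b), c - d *: b, b).
Proof.
rewrite /Wbar XbarE EbarE !XiZ !XiN !XiD /WV mulmxDl mulmxBl -!scalemxAl mul1mx.
by congr (_, _, _); entrywise; ring.
Qed.

Lemma YbarE a b c :
  Ybar (a, b, c) = (Y *m a + d *: rho (mu (X *m c)) - d *: (Y *m (X *m c)),
                    Y *m b - d *: rho c + d *: (Y *m mu c), rho c).
Proof.
rewrite [LHS]Xi_lin3 lin2_iota0.
rewrite (@lin2E _ _ qs _ _ (@xi1 R k \o mulmx Y)); first last.
- by move=> i j /=; rewrite mul_tens YV_vv.
- exact: linearP.
rewrite (@lin2E _ _ qs _ _ (((Wbar \o @xi1 R k \o rho)
   \+ d \*: (@xi1 R k \o mulmx Y \o mu)) \- d \*: (@iota0 R k \o mulmx Y \o mulmx X)));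
  first last.
- move=> i j; rewrite -(mul_tens Y) -(mul_tens X) /u_.
  have -> : tens (v i) (v j.+1) = rho (tens (v i) (v j)) by rewrite rho_tens YV_vv.
  have -> // : tens (v 1) (v (i + j)) = Y *m mu (tens (v i) (v j)).
  by rewrite mu_tens // (mul_tens Y) YV_vv.
- exact: linearP.
rewrite -[LHS]/(iota0 (Y *m a) + xi1 (Y *m b) + (Wbar (xi1 (rho c))
  + d *: xi1 (Y *m mu c) - d *: iota0 (Y *m (X *m c)))).
rewrite /iota0 /xi1 WbarE mulmx0 -rho_mulmx mu_rho // !XiZ !XiN !XiD.
by congr (_, _, _); entrywise; ring.
Qed.

Hypothesis q0_unit : qs 0%N \is a GRing.unit.
Hypothesis lam_unit : lam \is a GRing.unit.
Hypothesis delta_reg : GRing.lreg d.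
Hypothesis adm : admissible k q lam A qs.

Let lamE : lam - lam^-1 = d * (1 - A 0%N). Proof. by case: adm. Qed.
Let adm_h0 : forall l, (1 <= l <= k.-1)%N -> adm_h k q lam A qs l = 0.
Proof. by case: adm. Qed.
Let adm_beta0 : adm_beta k q lam qs = 0. Proof. by case: adm. Qed.

Let lamVE' : lam^-1 = lam - d * (1 - A 0%N). Proof. exact: lamVE. Qed.
Let lam2 : lam * lam = 1 + d * lam * (1 - A 0%N).
Proof. by rewrite -{1}(mulrV lam_unit) lamVE'; ring. Qed.

Let YXY (t : 'M[R]_k) : Y *m (X *m (Y *m t)) = W *m t.
Proof. by rewrite -(YXY_WV (lam := lam) (A := A)) // !mulmxA. Qed.
Let XYX (t : 'M[R]_k) : X *m (Y *m (X *m t)) = Y' *m t.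
Proof. by rewrite -(@XYX_V _ _ q lam A) // !mulmxA. Qed.
Let YY' (t : 'M[R]_k) : Y *m (Y' *m t) = t.
Proof. by rewrite mulmxA mulmxV ?mul1mx // YV_unitmx. Qed.
Let XW (t : 'M[R]_k) : X *m (W *m t) = t.
Proof. by rewrite mulmxA XV_WV // mul1mx. Qed.
Let WX (t : 'M[R]_k) : W *m (X *m t) = t.
Proof. by rewrite mulmxA WV_XV // mul1mx. Qed.
Let EX (t : 'M[R]_k) : E *m (X *m t) = lam *: (E *m t).
Proof. by rewrite mulmxA EV_XV // scalemxAl. Qed.
Let XE (t : 'M[R]_k) : X *m (E *m t) = lam *: (E *m t).
Proof. by rewrite mulmxA XV_EV // scalemxAl. Qed.
Let WE (t : 'M[R]_k) : W *m t = X *m t - d *: t + d *: (E *m t).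
Proof. by rewrite mulmxDl mulmxBl -!scalemxAl mul1mx. Qed.
Let Xmu t : X *m mu t = lam *: mu t.
Proof. by apply: mul_mu; rewrite XV_vv. Qed.
Let Wmu t : W *m mu t = lam^-1 *: mu t.
Proof. by apply: mul_mu; rewrite WV_v0. Qed.
Let Emu t : E *m mu t = A 0%N *: mu t.
Proof. by apply: mul_mu; rewrite EV_vv. Qed.

Lemma XbarK x : Xbar (Wbar x) = x.
Proof.
case: x => [[a b] c]; rewrite WbarE XbarE mulmxDr XW -scalemxAr Xmu.
by congr (_, _, _); entrywise; ring.
Qed.

Lemma WbarK x : Wbar (Xbar x) = x.
Proof.
case: x => [[a b] c]; rewrite XbarE WbarE mulmxBr WX -scalemxAr Wmu.
have := mulrV lam_unit; move: lam^-1 => l' l'E.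
by congr (_, _, _); entrywise; ring: l'E.
Qed.

Lemma Xbar_Ebar x : Xbar (Ebar x) = lam *: Ebar x.
Proof.
case: x => [[a b] c]; rewrite EbarE XbarE XiZ !mulmxDr XE -scalemxAr !Xmu mulmx0 !linear0.
by congr (_, _, _); entrywise; ring.
Qed.

(** The only nontrivial block is that of the third summand, where the coefficient of
    mu X is 1 + delta lambda (1 - A_0) = lambda^2. *)
Lemma Ebar_Xbar x : Ebar (Xbar x) = lam *: Ebar x.
Proof.
case: x => [[a b] c]; rewrite XbarE !EbarE XiZ mulmxBr EX -scalemxAr Emu.
rewrite !mulmxDr -scalemxAr muD muZ.
by congr (_, _, _); entrywise; ring: lam2.
Qed.

Lemma iter_Ybar_iota0 m t : iter m Ybar (iota0 t) = iota0 (Y ^+ m *m t).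
Proof.
elim: m => [|m IHm] /=; first by rewrite expr0 mul1mx.
by rewrite IHm Ybar_iota0 exprS -mulmxA.
Qed.

Lemma Ebar_Y_Ebar m x : (m < k)%N -> Ebar (iter m Ybar (Ebar x)) = A m *: Ebar x.
Proof.
move=> mk; case: x => [[a b] c].
set t := E *m a + mu (X *m b) + lam *: mu (X *m c).
have -> : Ebar (a, b, c) = iota0 t by exact: EbarE.
rewrite iter_Ybar_iota0.
rewrite Ebar_iota0 -linearZ /=; congr iota0.
have -> : t = mu t by rewrite /t !muD muZ !mu_mu // mu_EV.
rewrite /mu !mul_tens YV_pow_vv addn0 EV_vv //.
by rewrite /tens scalemxAl.
Qed.

(** The terms of [YbarE] involving delta are such that they nearly all cancel after
    applying [Xbar]. The formulas for X Y and Y X Y make the braid relation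
    and the relation for e Y X Y direct comparisons of blocks. *)
Lemma XbarYbarE a b c :
  Xbar (Ybar (a, b, c)) =
    (X *m (Y *m a) - d *: (Y' *m c), rho c, Y *m b + d *: (Y *m mu c)).
Proof.
rewrite YbarE XbarE !mulmxDr !mulmxN -!scalemxAr XYX -!rho_mulmx mu_rho // Xmu rhoZ.
by congr (_, _, _); entrywise; ring.
Qed.

Lemma YXYbarE a b c :
  Ybar (Xbar (Ybar (a, b, c))) =
    (W *m a - d *: c + d *: mu (W *m b) - d *: (W *m b),
     rho (Y *m (c - d *: b + d *: mu b)), rho (Y *m (b + d *: mu c))).
Proof.
rewrite XbarYbarE YbarE !(mulmxDr, mulmxN, muD, muN, rhoD, rhoN).
rewrite -!scalemxAr !(muZ, rhoZ) !YXY YY' -!scalemxAr.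
rewrite -2!mu_YV // !YXY !Wmu muZ !mu_mu // (mu_YV _ b) (mu_YV _ (mu c)) mu_mu //.
rewrite -!rho_mulmx.
by congr (_, _, _); entrywise; ring.
Qed.

Lemma Ebar_mu x : exists t, Ebar x = iota0 (mu t).
Proof.
case: x => [[a b] c]; exists (E *m a + mu (X *m b) + lam *: mu (X *m c)).
by rewrite !muD muZ !mu_mu // mu_EV //; apply: EbarE.
Qed.

Lemma YXYbar_Ebar x : Ybar (Xbar (Ybar (Ebar x))) = lam^-1 *: Ebar x.
Proof.
have [t ->] := Ebar_mu x; rewrite -linearZ !(Ybar_iota0, Xbar_iota0) YXY Wmu.
by [].
Qed.

Let muXrho (t : 'M[R]_k) : mu (X *m rho (Y *m t)) = mu (W *m t).
Proof. by rewrite -rho_mulmx mu_rho // -mu_YV // YXY. Qed.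

Lemma Ebar_YXYbar x : Ebar (Ybar (Xbar (Ybar x))) = lam^-1 *: Ebar x.
Proof.
have EW (t : 'M[R]_k) : E *m (W *m t) = lam^-1 *: (E *m t).
  by rewrite -{2}(XW t) EX scalerA mulVr // scale1r.
case: x => [[a b] c]; rewrite YXYbarE !EbarE !muXrho XiZ.
rewrite !(mulmxDr, mulmxN) -!scalemxAr !EW Emu !(muD, muN, muZ).
rewrite !Wmu !muZ !mu_mu // !WE !(muD, muN, muZ) !mu_EV // lamVE'.
by congr (_, _, _); entrywise; ring: lam2.
Qed.

Lemma braid_bar x :
  Xbar (Ybar (Xbar (Ybar x))) = Ybar (Xbar (Ybar (Xbar x))).
Proof.
case: x => [[a b] c]; rewrite YXYbarE XbarE XbarE YXYbarE muXrho.
rewrite !(mulmxDr, mulmxN) -!scalemxAr !XW !WX !Xmu !(muD, muN, muZ) !Wmu.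
rewrite !(muD, muN, muZ) !mu_mu // !(rhoD, rhoN, rhoZ).
rewrite mulmxDr -scalemxAr rhoD rhoZ.
rewrite !WE !(muD, muN, muZ) !mu_EV // lamVE'.
by congr (_, _, _); entrywise; ring: lam2.
Qed.

(** In the algebra this is Y X^-1 X = X^-1 X Y: the elements W u_{0,j} are to
    correspond to the powers Y^j. *)
Lemma Ybar_Wbar_xi1 t : Ybar (Wbar (xi1 (mu t))) = Wbar (xi1 (rho (mu t))).
Proof.
rewrite /xi1 !WbarE YbarE !mulmx0 !add0r -rho_mulmx !Xmu !(muZ, rhoZ) mu_rho //.
rewrite !mu_mu // !(mulmxDr, mulmxN, mulmx0) -!scalemxAr.
by congr (_, _, _); entrywise; ring.
Qed.

Local Notation endo := (lin_endo Xi).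
Let y : endo := mk_lin_endo Ybar.
Let x : endo := mk_lin_endo Xbar.
Let yE u : lapp y u = Ybar u. Proof. by []. Qed.
Let xE u : lapp x u = Xbar u. Proof. by []. Qed.
Let P : endo := y ^+ k - \sum_(i < k) lin_endo_scal Xi (qs i) * y ^+ i.

(** P vanishes on the image of any map that carries Y on columns to [Ybar]. *)
Let P_intertwine m (f : 'M[R]_(k, m) -> Xi) : linear f ->
  (forall t, Ybar (f t) = f (Y *m t)) -> forall t, lapp P (f t) = 0.
Proof.
move=> Lf fY t; pose g' := GRing.isLinear.Build _ _ _ _ f Lf.
pose F : {linear 'M[R]_(k, m) -> Xi} := HB.pack f g'.
have yf n : lapp (y ^+ n) (f t) = F (Y ^+ n *m t).
  elim: n => [|n IHn]; first by rewrite expr0 mul1mx.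
  rewrite exprS lappM IHn yE exprS -mulmxA; exact: fY.
rewrite lappD lappN lapp_sum yf YV_pow_k // mulmx_suml linear_sum.
apply/eqP; rewrite subr_eq0; apply/eqP/eq_bigr => i _.
by rewrite lappM lapp_scal yf -scalemxAl linearZ.
Qed.

Let P_iota0 t : lapp P (iota0 t) = 0.
Proof. by apply: P_intertwine => [|u]; [exact: linearP | rewrite Ybar_iota0]. Qed.

Lemma Ybar_xi1 t : Ybar (xi1 t) = xi1 (Y *m t).
Proof.
rewrite /xi1 YbarE !mulmx0 !(linear0 mu) !(linear0 rho) !mulmx0.
by congr (_, _, _); entrywise; ring.
Qed.

Let P_xi1 t : lapp P (xi1 t) = 0.
Proof. by apply: P_intertwine => [|u]; [exact: linearP | rewrite Ybar_xi1]. Qed.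

Lemma Ybar_Wbar_xi1_v0 b :
  Ybar (Wbar (xi1 (tens (v 0) b))) = Wbar (xi1 (tens (v 0) (Y *m b))).
Proof. by rewrite -rho_tens -(vmul_v0 qs b) // -/(mu _) Ybar_Wbar_xi1. Qed.

Let P_Wbar_xi1 b : lapp P (Wbar (xi1 (tens (v 0) b))) = 0.
Proof.
apply: (P_intertwine (f := fun b => Wbar (xi1 (tens (v 0) b)))) => [c r t|u].
  by rewrite /tens linearP /= mulmxDr -scalemxAr !linearP.
exact: Ybar_Wbar_xi1_v0.
Qed.

Let z := x * y * x.

(** The braid relation says that X Y X commutes with Y. *)
Let zP_comm : z * P = P * z.
Proof.
have zy : GRing.comm z y.
  have braid u : lapp (x * y * x * y) u = lapp (y * x * y * x) u := braid_bar u.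
  by rewrite /GRing.comm /z (lin_endoP braid) !mulrA.
apply: commrB; first exact: commrX.
apply: commr_sum => i _; apply: commrM; last exact: commrX.
exact: esym (lin_endo_scalC _ _).
Qed.

Let Wbar_xi1 t : Wbar (xi1 t) = iota0 (d *: mu (X *m t)) - d *: xi1 t + xi2 t.
Proof.
rewrite /iota0 /xi1 /xi2 WbarE !XiZ !XiN !XiD mulmx0.
by congr (_, _, _); entrywise; ring.
Qed.

Let P_Wbar_xi1_xi2 t : lapp P (Wbar (xi1 t)) = lapp P (xi2 t).
Proof.
rewrite Wbar_xi1 !lapp_add lapp_opp lapp_scale P_iota0 P_xi1.
by rewrite scaler0 subr0 add0r.
Qed.

(** W u_{i,j} and w_{i,j} differ by elements of the first two summands, which P kills;
    so P w_{i,j} = 0 implies P w_{i+1,j} = P Z W u_{i,j} = Z P W u_{i,j} = 0. *)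
Let P_xi2 i b : lapp P (xi2 (tens (v i) b)) = 0.
Proof.
elim: i => [|i IHi]; first by rewrite -P_Wbar_xi1_xi2 P_Wbar_xi1.
have -> : xi2 (tens (v i.+1) b) = lapp z (Wbar (xi1 (tens (v i) b))).
  rewrite /z !lappM !(xE, yE) XbarK Ybar_xi1 mul_tens YV_vv.
  by rewrite /xi1 XbarE !mulmx0 (linear0 mu) scaler0 subr0 scaler0 addr0.
rewrite -lappM -zP_comm lappM P_Wbar_xi1_xi2 IHi.
exact: lapp_zero.
Qed.

Lemma Ybar_pow_k : P = 0.
Proof.
apply: lin_endoP => -[[a b] c].
have -> : (a, b, c) = iota0 a + xi1 b + xi2 c :> Xi.
  by rewrite /iota0 /xi1 /xi2 !XiD !addr0 !add0r.
rewrite !lapp_add P_iota0 P_xi1 !add0r.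
apply: (@linear_tens_ext _ _ qs _ (lapp P \o @xi2 R k) (fun=> 0)).
- exact: linearP.
- by move=> ? ? ?; rewrite scaler0 addr0.
by move=> i j; apply: P_xi2.
Qed.

End ModuleXi.

(** * The algebra and the map phi *)

Section AlgebraB.
Variables (R : comUnitRingType) (k : nat) (q lam : R) (A qs : nat -> R).

Local Notation d := (delta q).
Local Notation v := (vv k qs).
Local Notation B := (bmw k q lam A qs).
Local Notation bY := (bY k q lam A qs).
Local Notation bYinv := (bYinv k q lam A qs).
Local Notation bX := (bX k q lam A qs).
Local Notation bXinv := (bXinv k q lam A qs).
Local Notation be := (be k q lam A qs).
Local Notation XVv := (XVv k q lam A qs).
Local Notation phi := (@phi R k q lam A qs).

Let rel := bmw_satisfies k q lam A qs.
Let scal1 c (b : B) : (c *: (1 : B)) * b = c *: b.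
Proof. by rewrite -bmw_scalerAl mul1r. Qed.

Let YYV : bY * bYinv = 1. Proof. by case: rel => -[]. Qed.
Let YVY : bYinv * bY = 1. Proof. by case: rel => -[]. Qed.
Let XXV : bX * bXinv = 1. Proof. by case: rel => _ []. Qed.
Let XVX : bXinv * bX = 1. Proof. by case: rel => _ []. Qed.
Let Yk : bY ^+ k = \sum_(i < k) qs i *: bY ^+ i.
Proof. by rewrite (rel_Yk rel); apply: eq_bigr => i _; rewrite scal1. Qed.
Let Xe : bX * be = lam *: be. Proof. by have [-> _] := rel_Xe rel; rewrite scal1. Qed.
Let eX : be * bX = lam *: be. Proof. by have [_ ->] := rel_Xe rel; rewrite scal1. Qed.
Let YXYe : bY * bX * bY * be = lam^-1 *: be.
Proof. by have [-> _] := rel_YXYe rel; rewrite scal1. Qed.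
Let eYXY : be * bY * bX * bY = lam^-1 *: be.
Proof. by have [_ ->] := rel_YXYe rel; rewrite scal1. Qed.
Let eYe m : (m < k)%N -> be * bY ^+ m * be = A m *: be.
Proof. by move=> mk; rewrite (rel_eYe rel mk) scal1. Qed.
Let XVE : bXinv = bX - d *: (1 : B) + d *: be.
Proof.
have := rel_skein rel; rewrite scal1 scalerBr => skein.
by rewrite -addrA [- _ + _]addrC -opprB -skein subKr.
Qed.

Let XYX_comm : GRing.comm (bX * bY * bX) bY.
Proof. by rewrite /GRing.comm (rel_braid rel) !mulrA. Qed.

Hypothesis lam_unit : lam \is a GRing.unit.

Let XYe : bX * bY * be = lam^-1 *: (bYinv * be).
Proof. by rewrite bmw_scalerAr -YXYe !mulrA YVY mul1r. Qed.
Let eYX : be * bY * bX = lam^-1 *: (be * bYinv).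
Proof. by rewrite bmw_scalerAl -eYXY -!mulrA YYV mulr1. Qed.

Let XYXe : bX * bY * bX * be = bYinv * be.
Proof.
by rewrite -mulrA Xe -bmw_scalerAr XYe scalerA mulrV // scale1r.
Qed.
Let eXYX : be * bX * bY * bX = be * bYinv.
Proof.
by rewrite eX -!bmw_scalerAl eYX scalerA mulrV // scale1r.
Qed.

(** Since X Y X commutes with Y, one has Y X Y^j e = X^-1 (X Y X) Y^j e =
    X^-1 Y^(j-1) e, and X^-1 is rewritten by the skein relation. *)
Let XYe_rec i : bX * (bY ^+ i.+2 * be)
  = bYinv * (bX * (bY ^+ i.+1 * be)) - d *: (bY ^+ i * be)
    + d *: (bYinv * (be * bY ^+ i.+1 * be)).
Proof.
have := commrX i.+2 XYX_comm; rewrite [bY ^+ i.+2]exprSr.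
have : bY ^+ i.+1 = bY * bY ^+ i by rewrite exprS.
move: (bY ^+ i.+1) (bY ^+ i) => p1 p p1E comm2.
have XYXY : bX * (bY * bX * (p1 * bY) * be) = p1 * be.
  rewrite !mulrA -(mulrA _ p1 bY) comm2.
  by rewrite -mulrA XYXe -!mulrA (mulrA bY) YYV mul1r.
have -> : bX * (p1 * bY * be) = bYinv * (bXinv * (p1 * be)).
  by rewrite -XYXY !mulrA -(mulrA bYinv) XVX mulr1 YVY mul1r.
rewrite XVE !mulrDl mulNr !mulrDr mulrN -!bmw_scalerAl -!bmw_scalerAr mul1r.
by rewrite [in X in _ - X]p1E !mulrA YVY mul1r.
Qed.

Let eYX_rec i : be * bY ^+ i.+2 * bX
  = be * bY ^+ i.+1 * bX * bYinv - d *: (be * bY ^+ i)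
    + d *: (be * bY ^+ i.+1 * be * bYinv).
Proof.
have := commrX i.+2 XYX_comm; rewrite [bY ^+ i.+2]exprS.
have : bY ^+ i.+1 = bY ^+ i * bY by rewrite exprSr.
move: (bY ^+ i.+1) (bY ^+ i) => p1 p p1E comm2.
have YXYX : be * (bY * p1) * bX * bY * bX = be * p1.
  have -> : be * (bY * p1) * bX * bY * bX = be * (bY * p1 * (bX * bY * bX)).
    by rewrite !mulrA.
  rewrite -comm2 !(mulrA be) eXYX.
  by rewrite -mulrA (mulrA bYinv) YVY mul1r.
have -> : be * (bY * p1) * bX = be * p1 * bXinv * bYinv.
  by rewrite -YXYX -!mulrA (mulrA bX bXinv) XXV mul1r YYV mulr1.
rewrite XVE !mulrDr mulrN !mulrDl mulNr -!bmw_scalerAr -!bmw_scalerAl mulr1.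
by rewrite [in X in _ - X]p1E -!mulrA YYV mulr1.
Qed.

Hypothesis k_gt0 : (0 < k)%N.
Hypothesis q0_unit : qs 0%N \is a GRing.unit.

(** The substitution v_i |-> Y^i. *)
Definition evalY (a : 'cV[R]_k) : B := \sum_(i < k) a i 0 *: bY ^+ i.

Fact evalY_is_linear : linear evalY.
Proof.
move=> c a b; rewrite /evalY scaler_sumr -big_split; apply: eq_bigr => i _ /=.
by rewrite !mxE scalerDl scalerA.
Qed.
HB.instance Definition _ := GRing.isLinear.Build R 'cV[R]_k B *:%R evalY evalY_is_linear.

Let evalYD : {morph evalY : a b / a + b}. Proof. exact: linearD. Qed.
Let evalYN : {morph evalY : a / - a}. Proof. exact: linearN. Qed.
Let evalYZ c : {morph evalY : a / c *: a}. Proof. exact: linearZ. Qed.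

Let evalY_vv_lt i : (i < k)%N -> evalY (v i) = bY ^+ i.
Proof.
move=> ik; rewrite /evalY (bigD1 (Ordinal ik)) //= vv_basis // mxE eqxx scale1r.
rewrite big1 ?addr0 // => j nij; rewrite mxE -val_eqE in nij *.
by rewrite (negbTE nij) scale0r.
Qed.

Lemma evalY_YV a : evalY (YV k qs *m a) = bY * evalY a.
Proof.
have -> : a = \sum_(i < k) a i 0 *: v i.
  apply/colP => j; rewrite summxE (bigD1 j) //= vv_basis // !mxE eqxx mulr1.
  rewrite big1 ?addr0 // => i nij; rewrite vv_basis // !mxE val_eqE eq_sym.
  by rewrite (negbTE nij) mulr0.
rewrite mulmx_sumr !linear_sum mulr_sumr; apply: eq_bigr => i _ /=.
rewrite -scalemxAr !linearZ /= -bmw_scalerAr YV_vv (evalY_vv_lt (ltn_ord i)) -exprS.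
congr (_ *: _); have [|ki] := ltnP i.+1 k; first exact: evalY_vv_lt.
have -> : i.+1 = k by have := ltn_ord i; lia.
rewrite Yk vv_k // linear_sum; apply: eq_bigr => j _.
by rewrite linearZ /= evalY_vv_lt.
Qed.

Lemma evalY_vv i : evalY (v i) = bY ^+ i.
Proof.
by elim: i => [|i IHi]; [exact: evalY_vv_lt | rewrite -YV_vv evalY_YV IHi exprS].
Qed.

Lemma evalY_YVinv a : evalY (invmx (YV k qs) *m a) = bYinv * evalY a.
Proof.
rewrite -{2}[a](mul1mx a) -(mulmxV (YV_unitmx k_gt0 q0_unit)) -mulmxA evalY_YV.
by rewrite mulrA YVY mul1r.
Qed.

Lemma evalY_comm a : GRing.comm (evalY a) bY.
Proof.
apply: commr_sym; apply: commr_sum => i _; rewrite /GRing.comm.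
by rewrite -bmw_scalerAr -bmw_scalerAl -exprS -exprSr.
Qed.

Let evalY_commV a : GRing.comm (evalY a) bYinv.
Proof.
rewrite /GRing.comm -[LHS]mul1r -YVY -mulrA (mulrA bY) -(evalY_comm a).
by rewrite -!mulrA YYV mulr1.
Qed.

Let XVvSS i : XVv i.+2 = invmx (YV k qs) *m XVv i.+1 - d *: v i
  + (d * A i.+1) *: (invmx (YV k qs) *m v 0).
Proof. by []. Qed.

(** In the algebra, X Y^i e obeys the recursion by which X_V was defined. *)
Lemma bX_evalY_be i : (i < k)%N -> bX * (bY ^+ i * be) = evalY (XVv i) * be.
Proof.
elim/ltn_ind: i => -[|[|i]] IHi ik.
- by rewrite /= evalYZ evalY_vv mul1r -bmw_scalerAl mul1r Xe.
- by rewrite /= evalYZ evalY_YVinv evalY_vv mulr1 mulrA XYe bmw_scalerAl.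
rewrite XYe_rec IHi ?(ltnW ik) // eYe ?(ltnW ik) //.
rewrite XVvSS !evalYD evalYN !evalYZ.
rewrite !evalY_YVinv !evalY_vv mulr1 !(mulrDl _ _ be) mulNr -!bmw_scalerAl -!bmw_scalerAr.
by rewrite scalerA mulrA.
Qed.

(** The image of [bX_evalY_be] under the anti-automorphism of the algebra that fixes
    the generators, proved directly from the mirrored recursion. *)
Lemma be_evalY_bX i : (i < k)%N -> be * bY ^+ i * bX = be * evalY (XVv i).
Proof.
elim/ltn_ind: i => -[|[|i]] IHi ik.
- by rewrite /= evalYZ evalY_vv mulr1 -bmw_scalerAr mulr1 eX.
- by rewrite /= evalYZ evalY_YVinv evalY_vv mulr1 eYX bmw_scalerAr.
rewrite eYX_rec IHi ?(ltnW ik) // eYe ?(ltnW ik) //.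
rewrite XVvSS !evalYD evalYN !evalYZ.
rewrite !evalY_YVinv !evalY_vv mulr1 !(mulrDr be) mulrN -!bmw_scalerAl -!bmw_scalerAr.
by rewrite scalerA -mulrA evalY_commV.
Qed.

Local Notation Xi := (Xi R k).
Local Notation Ebar := (@Ebar R k q lam A qs).
Local Notation Xbar := (@Xbar R k q lam A qs).
Local Notation Ybar := (@Ybar R k q lam A qs).
Local Notation Wbar := (@Wbar R k q lam A qs).

Lemma lin2_evalY (g h : B) a b :
  lin2 (fun i j => g * bY ^+ i * h * bY ^+ j) (tens a b)
  = g * evalY a * h * evalY b.
Proof.
rewrite /lin2 /evalY [g * _]mulr_sumr 2!mulr_suml; apply: eq_bigr => i _.
rewrite mulr_sumr; apply: eq_bigr => j _.
rewrite /tens mxE big_ord1 mxE -!bmw_scalerAr -!bmw_scalerAl.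
by rewrite scalerA mulrC.
Qed.

Let lin2_evalY1 (h : B) a b :
  lin2 (fun i j => bY ^+ i * h * bY ^+ j) (tens a b) = evalY a * h * evalY b.
Proof.
rewrite -[in RHS](mul1r (evalY a)) -lin2_evalY.
by apply: eq_bigr => i _; apply: eq_bigr => j _; rewrite mul1r.
Qed.

Let phi3 (a b c : 'M[R]_k) : phi (a, b, c) =
  lin2 (fun i j => bY ^+ i * be * bY ^+ j) a
  + lin2 (fun i j => bY ^+ i * bX * bY ^+ j) b
  + lin2 (fun i j => bX * bY ^+ i * bX * bY ^+ j) c.
Proof. by []. Qed.

Lemma phi_iota0 a b : phi (iota0 (tens a b)) = evalY a * be * evalY b.
Proof. by rewrite phi3 !linear0 !addr0 lin2_evalY1. Qed.

Lemma phi_xi1 a b : phi (xi1 (tens a b)) = evalY a * bX * evalY b.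
Proof. by rewrite phi3 !linear0 addr0 add0r lin2_evalY1. Qed.

Lemma phi_xi2 a b : phi (xi2 (tens a b)) = bX * evalY a * bX * evalY b.
Proof. by rewrite phi3 !linear0 !add0r lin2_evalY. Qed.

Lemma phi_v i j : phi (v_ k qs i j) = bY ^+ i * be * bY ^+ j.
Proof. by rewrite /v_ phi_iota0 !evalY_vv. Qed.
Lemma phi_u i j : phi (u_ k qs i j) = bY ^+ i * bX * bY ^+ j.
Proof. by rewrite /u_ phi_xi1 !evalY_vv. Qed.
Lemma phi_w i j : phi (w_ k qs i j) = bX * bY ^+ i * bX * bY ^+ j.
Proof. by rewrite /w_ phi_xi2 !evalY_vv. Qed.

Let phiD : {morph phi : x y / x + y}. Proof. exact: linearD. Qed.
Let phiN : {morph phi : x / - x}. Proof. exact: linearN. Qed.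
Let phiZ c : {morph phi : x / c *: x}. Proof. exact: linearZ. Qed.

Lemma Xi_linear_ext (M : lmodType R) (f g : Xi -> M) :
  linear f -> linear g ->
  (forall i j : 'I_k, [/\ f (v_ k qs i j) = g (v_ k qs i j),
     f (u_ k qs i j) = g (u_ k qs i j) & f (w_ k qs i j) = g (w_ k qs i j)]) ->
  f =1 g.
Proof.
move=> Lf Lg fg [[a b] c].
pose f' := GRing.isLinear.Build _ _ _ _ f Lf.
pose g' := GRing.isLinear.Build _ _ _ _ g Lg.
pose F : {linear Xi -> M} := HB.pack f f'.
pose G : {linear Xi -> M} := HB.pack g g'.
have -> : (a, b, c) = iota0 a + xi1 b + xi2 c :> Xi.
  by rewrite /iota0 /xi1 /xi2 !XiD !addr0 !add0r.
rewrite -[f _]/(F _) -[g _]/(G _) !linearD; congr (_ + _ + _).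
- apply: (@linear_tens_ext _ _ qs _ (F \o @iota0 R k) (G \o @iota0 R k)) => [||i j];
    [exact: linearP|exact: linearP|by case: (fg i j)].
- apply: (@linear_tens_ext _ _ qs _ (F \o @xi1 R k) (G \o @xi1 R k)) => [||i j];
    [exact: linearP|exact: linearP|by case: (fg i j)].
apply: (@linear_tens_ext _ _ qs _ (F \o @xi2 R k) (G \o @xi2 R k)) => [||i j];
    [exact: linearP|exact: linearP|by case: (fg i j)].
Qed.

Let phi_hom_ext (b : B) (F : Xi -> Xi) : linear F ->
  (forall i j : 'I_k, [/\ phi (F (v_ k qs i j)) = b * phi (v_ k qs i j),
     phi (F (u_ k qs i j)) = b * phi (u_ k qs i j)
     & phi (F (w_ k qs i j)) = b * phi (w_ k qs i j)]) ->
  forall x, phi (F x) = b * phi x.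
Proof.
move=> LF; apply: (@Xi_linear_ext _ (phi \o F) (fun x => b * phi x)).
  by move=> c x y /=; rewrite LF linearP.
by move=> c x y; rewrite phiD phiZ mulrDr bmw_scalerAr.
Qed.

Let phi_Ebar_u (i j : 'I_k) :
  phi (Ebar_u k q lam A qs i j) = be * bY ^+ i * bX * bY ^+ j.
Proof.
rewrite /Ebar_u phi_iota0 evalY_vv mul1r be_evalY_bX // -!mulmxA.
have -> : YV k qs ^+ i *m v 0 = v i by rewrite YV_pow_vv addn0.
rewrite XV_vv // -mulrA; congr (_ * _).
elim: (j : nat) => [|n IHn]; first by rewrite expr0 mul1mx mulr1.
rewrite exprS -mulmxA evalY_YV IHn mulrA -evalY_comm -mulrA.
by rewrite -exprS.
Qed.

Lemma phi_Ebar x : phi (Ebar x) = be * phi x.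
Proof.
apply: (@phi_hom_ext be Ebar) => [|i j]; [exact: linearP | split].
- rewrite /v_ Ebar_iota0 mul_tens EV_vv // !phi_iota0 evalYZ !evalY_vv.
  by rewrite !mulrA eYe // -!bmw_scalerAl expr0 mul1r.
- by rewrite Ebar_uE phi_Ebar_u phi_u !mulrA.
rewrite [Ebar _]Xi_lin_w phi_w.
rewrite Ebar_w_scale //.
by rewrite phiZ phi_Ebar_u !mulrA eX -!bmw_scalerAl.
Qed.

Lemma phi_Xbar x : phi (Xbar x) = bX * phi x.
Proof.
apply: (@phi_hom_ext bX Xbar) => [|i j]; [exact: linearP | split].
- rewrite /v_ Xbar_iota0 mul_tens XV_vv // !phi_iota0 !evalY_vv.
  by rewrite -bX_evalY_be // !mulrA.
- by rewrite [Xbar _]Xi_lin_u phi_w phi_u !mulrA.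
rewrite [Xbar _]Xi_lin_w !(phiD, phiN, phiZ) phi_u !phi_w phi_Ebar_u.
have XX : bX * bX = 1 + d *: bX - (d * lam) *: be.
  rewrite -XXV XVE !mulrDr mulrN -!bmw_scalerAr mulr1 Xe scalerA.
  by rewrite (addrAC (_ - _)) subrK addrK.
rewrite -!mulrA (mulrA bX bX) XX !mulrDl mulNr mul1r -!bmw_scalerAl.
by [].
Qed.

Lemma phi_Wbar x : phi (Wbar x) = bXinv * phi x.
Proof.
rewrite /Wbar (phiD (_ - _)) (phiD (Xbar x)) phiN !phiZ phi_Xbar phi_Ebar XVE !mulrDl mulNr.
by rewrite -!bmw_scalerAl mul1r.
Qed.

(** For w_{i,j} the point is that Y X Y^i X^-1 = X^-1 Y^i X Y, because X Y X commutes
    with Y^i. *)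
Lemma phi_Ybar x : phi (Ybar x) = bY * phi x.
Proof.
apply: (@phi_hom_ext bY Ybar) => [|i j]; [exact: linearP | split].
- by rewrite /v_ Ybar_iota0 mul_tens YV_vv !phi_iota0 !evalY_vv !mulrA -exprS.
- by rewrite [Ybar _]Xi_lin_u !phi_u !mulrA -exprS.
rewrite [Ybar _]Xi_lin_w (phiD (_ + _)) (phiD (Wbar _)) phiN !phiZ phi_Wbar !phi_u.
rewrite phi_w phi_iota0 evalY_YV XV_vv // evalY_vv -(mulrA bY) -bX_evalY_be //.
have := commrX i XYX_comm; rewrite exprD exprS expr1.
move: (bY ^+ i) (bY ^+ j) => p r comm.
have -> : bXinv * (p * bX * (bY * r)) = bY * bX * p * bXinv * r.
  have -> : p * bX * (bY * r) = p * (bX * bY * bX) * bXinv * r.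
    by rewrite -!mulrA (mulrA bX bXinv) XXV mul1r.
  by rewrite -comm !mulrA XVX mul1r.
rewrite XVE !(mulrDr (bY * bX * p)) mulrN !(mulrDl _ _ r) mulNr -!bmw_scalerAr.
rewrite -!bmw_scalerAl mulr1 !mulrA.
by rewrite (addrAC (_ - _)) subrK addrK.
Qed.

End AlgebraB.

(** * The action and the isomorphism *)

Lemma inverse_of_monic_relation (R : comUnitRingType) (B : pzRingType)
    (f : {rmorphism R -> B}) (k : nat) (c : nat -> R) (y : B) :
  (forall a b, f a * b = b * f a) -> (0 < k)%N -> c 0%N \is a GRing.unit ->
  y ^+ k = \sum_(i < k) f (c i) * y ^+ i ->
  exists y', y * y' = 1 /\ y' * y = 1.
Proof.
case: k => // k fC _ c0 yk.
pose g := y ^+ k - \sum_(i < k) f (c i.+1) * y ^+ i.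
have gy : g * y = f (c 0%N).
  rewrite mulrBl -exprSr yk big_ord_recl mulr1 mulr_suml.
  rewrite (eq_bigr (fun i : 'I_k => f (c i.+1) * y ^+ i * y)) ?addrK //.
  by move=> i _; rewrite -mulrA -exprSr.
have yg : y * g = g * y.
  rewrite mulrBr mulrBl -exprS -exprSr mulr_sumr mulr_suml; congr (_ - _).
  by apply: eq_bigr => i _; rewrite mulrA -fC -!mulrA -exprS -exprSr.
exists (f (c 0%N)^-1 * g); split.
  by rewrite mulrA -fC -mulrA yg gy -rmorphM mulVr ?rmorph1.
by rewrite -mulrA gy -rmorphM mulVr ?rmorph1.
Qed.

Section BasisTransport.
Variables (R : pzRingType) (M : lmodType R).

Lemma is_basis_reindex (I J : finType) (b : I -> M) (h : J -> I) :
  bijective h -> is_basis b -> is_basis (b \o h).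
Proof.
case=> g hK gK [b_free b_span]; split=> [c c0 j | x].
  rewrite -(hK j); apply: (b_free (c \o g)); rewrite -[RHS]c0.
  rewrite (reindex h) /=; last by exists g => ? _.
  by apply: eq_bigr => i _; rewrite hK.
have [c ->] := b_span x; exists (c \o h).
by rewrite (reindex h) //; exists g => ? _.
Qed.

Lemma is_basis_free_of_rank (I : finType) (b : I -> M) n :
  #|I| = n -> is_basis b -> free_of_rank M n.
Proof.
move=> In bb; exists (b \o (@enum_val I predT \o cast_ord (esym In))).
apply: is_basis_reindex bb; apply: bij_comp; first exact: enum_val_bij.
by exists (cast_ord In) => i; rewrite ?cast_ordK ?cast_ordKV.
Qed.

End BasisTransport.

Section Iso.
Variables (R : comUnitRingType) (k : nat) (q lam : R) (A qs : nat -> R).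
Hypothesis k_gt0 : (0 < k)%N.
Hypothesis q0_unit : qs 0%N \is a GRing.unit.
Hypothesis lam_unit : lam \is a GRing.unit.
Hypothesis delta_reg : GRing.lreg (delta q).
Hypothesis adm : admissible k q lam A qs.

Local Notation d := (delta q).
Local Notation v := (vv k qs).
Local Notation B := (bmw k q lam A qs).
Local Notation bY := (bY k q lam A qs).
Local Notation bYinv := (bYinv k q lam A qs).
Local Notation bX := (bX k q lam A qs).
Local Notation bXinv := (bXinv k q lam A qs).
Local Notation be := (be k q lam A qs).
Local Notation phi := (@phi R k q lam A qs).
Local Notation Xi := (Xi R k).
Local Notation Ebar := (@Ebar R k q lam A qs).
Local Notation Xbar := (@Xbar R k q lam A qs).
Local Notation Ybar := (@Ybar R k q lam A qs).
Local Notation Wbar := (@Wbar R k q lam A qs).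
Local Notation endo := (lin_endo Xi).

Lemma Xi_relations : exists y' : endo,
  bmw_relations k q lam A qs (lin_endo_scal Xi) (mk_lin_endo Ybar) y'
    (mk_lin_endo Xbar) (mk_lin_endo Wbar) (mk_lin_endo Ebar).
Proof.
have yk : mk_lin_endo Ybar ^+ k = \sum_(i < k) lin_endo_scal Xi (qs i) * mk_lin_endo Ybar ^+ i.
  by apply/eqP; rewrite -subr_eq0; apply/eqP; apply: Ybar_pow_k.
have [y' [yy' y'y]] := inverse_of_monic_relation (@lin_endo_scalC _ Xi) k_gt0 q0_unit yk.
exists y'; split; first by split.
- by split; apply: lin_endoP => x; [apply: XbarK | apply: WbarK].
- exact: yk.
- apply: lin_endoP => x; rewrite -[LHS]/(Xbar x - Wbar x).
  rewrite -[RHS]/(d *: (x - Ebar x)) /Defs.Wbar.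
  rewrite -[X in _ - X]addrA opprD [LHS]addrA subrr add0r.
  by rewrite scalerBr opprD opprK.
- by apply: lin_endoP => x; apply: braid_bar.
- by split; apply: lin_endoP => x; [apply: Xbar_Ebar | apply: Ebar_Xbar].
- by split; apply: lin_endoP => x; [apply: YXYbar_Ebar | apply: Ebar_YXYbar].
move=> m mk; apply: lin_endoP => x; rewrite -[RHS]/(A m *: Ebar x) -Ebar_Y_Ebar //.
rewrite 2!lappM; congr Ebar.
by elim: m {mk} => //= m IHm; rewrite exprS lappM IHm.
Qed.

Lemma Xi_action_exists : exists act, @Xi_action R k q lam A qs act.
Proof.
have [y' /(bmw_universal (@lin_endo_scalC _ Xi))] := Xi_relations.
set F := bmw_lift _ _ _ _ _ _; case=> [[FB [F1 FM] FZ [FY FYV FX FXV Fe]] _].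
have F0 : F 0 = 0 by rewrite -(subrr 0) FB subrr.
have FN b : F (- b) = - F b by rewrite -sub0r FB F0 sub0r.
exists (fun b x => lapp (F b) x); split.
- split=> [x|b c x|b c x|b x y|c x].
  + by rewrite F1.
  + by rewrite FM.
  + by rewrite -[c in LHS]opprK FB FN opprK.
  + exact: lapp_add.
  + by rewrite FZ F1 mulr1.
- by rewrite FY.
- by rewrite FX.
- by rewrite FXV.
- by rewrite Fe.
Qed.

Section WithAction.
Variable act : B -> Xi -> Xi.
Hypothesis actP : Xi_action act.

Let actM b c x : act (b * c) x = act b (act c x).
Proof. by case: actP => -[]. Qed.
Let actD b c x : act (b + c) x = act b x + act c x.
Proof. by case: actP => -[]. Qed.
Let act_scalar c x : act (c *: (1 : B)) x = c *: x.
Proof. by case: actP => -[]. Qed.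
Let actZ c b x : act (c *: b) x = c *: act b x.
Proof. by rewrite -[b]mul1r bmw_scalerAl actM act_scalar mul1r. Qed.
Let actYE x : act bY x = Ybar x. Proof. by case: actP. Qed.
Let actXE x : act bX x = Xbar x. Proof. by case: actP. Qed.
Let acteE x : act be x = Ebar x. Proof. by case: actP. Qed.

Let actYn n x : act (bY ^+ n) x = iter n Ybar x.
Proof.
by elim: n => [|n IHn]; [case: actP => -[] | rewrite exprS actM IHn actYE].
Qed.

Let phiD : {morph phi : x y / x + y}. Proof. exact: linearD. Qed.

(** By induction on an expression representing b; the case of Y^-1 follows from that
    of Y. *)
Lemma phi_act b x : phi (act b x) = b * phi x.
Proof.
have VYK u : bYinv * (bY * u) = u.
  by have [[_ VY] _ _ _ _ _ _ _] := bmw_satisfies k q lam A qs; rewrite mulrA VY mul1r.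
elim/bmw_ind: b x => t; elim: t => [||||| c | s IHs t IHt | s IHs t IHt] x.
- by rewrite actYE phi_Ybar.
- rewrite -[LHS]VYK -phi_Ybar // -actYE -actM; congr (bYinv * phi _).
  have [[YV _] _ _ _ _ _ _ _] := bmw_satisfies k q lam A qs.
  by rewrite [_ * _]YV; case: actP => -[].
- by rewrite actXE phi_Xbar.
- by have [_ _ _ -> _] := actP; rewrite phi_Wbar.
- by rewrite acteE phi_Ebar.
- by rewrite clscal act_scalar linearZ -bmw_scalerAl mul1r.
- by rewrite clD actD phiD IHs IHt mulrDl.
by rewrite clM actM IHs IHt mulrA.
Qed.

(** The element that phi sends to X^-1 X = 1; acting on it inverts phi. *)
Let x0 := Wbar (u_ k qs 0 0).

Let phi_x0 : phi x0 = 1.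
Proof.
rewrite /x0 phi_Wbar // phi_u // !expr0 mul1r mulr1.
by have [_ [_ ->] _ _ _ _ _ _] := bmw_satisfies k q lam A qs.
Qed.

Let YV_pow_vv0 i : YV k qs ^+ i *m v 0 = v i.
Proof. by rewrite YV_pow_vv addn0. Qed.

Let iter_Ybar_x0 j : iter j Ybar x0 = Wbar (u_ k qs 0 j).
Proof.
elim: j => [//|j IHj]; rewrite iterS IHj /u_ -YV_vv.
exact: Ybar_Wbar_xi1_v0.
Qed.

Let iter_Ybar_u i j : iter i Ybar (u_ k qs 0 j) = u_ k qs i j.
Proof. by elim: i => //= i ->; rewrite /u_ Ybar_xi1 // mul_tens YV_vv. Qed.

Let act_v i j : (j < k)%N -> act (bY ^+ i * be * bY ^+ j) x0 = v_ k qs i j.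
Proof.
move=> jk; rewrite !actM !actYn acteE iter_Ybar_x0.
have -> : Ebar (Wbar (u_ k qs 0 j)) = v_ k qs 0 j.
  rewrite -[LHS]scale1r -(mulVr lam_unit) -scalerA -Ebar_Xbar // XbarK //.
  rewrite (Ebar_uE q lam A qs (Ordinal k_gt0) (Ordinal jk)) /Ebar_u /= -!mulmxA.
  rewrite expr0 mul1mx XV_vv //= -linearZ /v_ /tens /=; congr iota0.
  rewrite -scalemxAr YV_pow_vv0 linearZ /= -scalemxAr scalerA mulVr // scale1r.
  by [].
by rewrite /v_ iter_Ybar_iota0 mul_tens YV_pow_vv0.
Qed.

Let act_u i j : act (bY ^+ i * bX * bY ^+ j) x0 = u_ k qs i j.
Proof. by rewrite !actM !actYn actXE iter_Ybar_x0 XbarK // iter_Ybar_u. Qed.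

Let act_w (i j : 'I_k) : act (bX * bY ^+ i * bX * bY ^+ j) x0 = w_ k qs i j.
Proof. by rewrite -!mulrA actM (mulrA (bY ^+ i)) act_u actXE [LHS]Xi_lin_u. Qed.

Lemma act_phi x : act (phi x) x0 = x.
Proof.
move: x; apply: (@Xi_linear_ext _ _ qs _ (fun x => act (phi x) x0) id) => //.
  by move=> c x y; rewrite linearP actD actZ.
by move=> i j; rewrite !(phi_v, phi_u, phi_w) // act_v ?act_u ?act_w.
Qed.

Lemma phi_module_iso : is_module_iso act phi.
Proof.
split; [exact: linearP | exact: phi_act |].
exists (fun b => act b x0); first exact: act_phi.
by move=> b; rewrite phi_act phi_x0 mulr1.
Qed.

End WithAction.

Lemma phi_bijective : bijective phi.
Proof.
have [act actP] := Xi_action_exists.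
exact: iso_bij (phi_module_iso actP).
Qed.

(** A combination of the family with coefficients c is phi of the triple of matrices
    with entries c, so bijectivity of phi is the basis property. *)
Lemma bmw_basis_family_is_basis : is_basis (@bmw_basis_family R k q lam A qs).
Proof.
pose elt (c : 'I_k * 'I_k + 'I_k * 'I_k + 'I_k * 'I_k -> R) : Xi :=
  (\matrix_(i, j) c (inl (inl (i, j))), \matrix_(i, j) c (inl (inr (i, j))),
   \matrix_(i, j) c (inr (i, j))).
have phi_elt c : phi (elt c) = \sum_s c s *: bmw_basis_family q lam A qs s.
  rewrite !big_sumType /=; congr (_ + _ + _); rewrite /lin2 pair_bigA;
    by apply: eq_bigr => -[i j] _; rewrite mxE.
have [g phiK gK] := phi_bijective.
split=> [c c0 s | x].
  have : elt c = 0 by rewrite -[LHS]phiK phi_elt c0 -(linear0 phi) phiK.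
  case=> /matrixP c1 /matrixP c2 /matrixP c3.
  case: s => [[[i j]|[i j]]|[i j]].
  - by have := c1 i j; rewrite !mxE.
  - by have := c2 i j; rewrite !mxE.
  by have := c3 i j; rewrite !mxE.
pose c s := match s with
  | inl (inl (i, j)) => (g x).1.1 i j
  | inl (inr (i, j)) => (g x).1.2 i j
  | inr (i, j) => (g x).2 i j end.
exists c; rewrite -phi_elt -[LHS]gK; congr phi.
rewrite [LHS]surjective_pairing [X in (X, _)]surjective_pairing.
by congr (_, _, _); apply/matrixP => i j; rewrite mxE.
Qed.

End Iso.

Theorem theorem4p3 (R : comUnitRingType) (k : nat) (q lam : R) (A qs : nat -> R)
    (k_ge1 : (1 <= k)%N)
    (q0_unit : qs 0%N \is a GRing.unit) (q_unit : q \is a GRing.unit)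
    (lam_unit : lam \is a GRing.unit)
    (delta_reg : GRing.lreg (delta q))
    (adm : admissible k q lam A qs) :
  (exists2 act : bmw k q lam A qs -> Xi R k -> Xi R k,
     Xi_action act & is_module_iso act (@phi R k q lam A qs))
  /\ free_of_rank (bmw k q lam A qs) (3 * k ^ 2)
  /\ is_basis (@bmw_basis_family R k q lam A qs).
Proof.
have basisB := bmw_basis_family_is_basis k_ge1 q0_unit lam_unit delta_reg adm.
split; last split=> //.
  have [act actP] := Xi_action_exists k_ge1 q0_unit lam_unit delta_reg adm.
  by exists act => //; apply: phi_module_iso.
apply: is_basis_free_of_rank basisB.
by rewrite !card_sum !card_prod !card_ord; lia.
Qed.
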